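(* Let $A$ be an abelian $C^*$-algebra that is not finitely generated as a $C^*$-algebra. Then $$w(\Delta(A))=d(A)=\mathrm{gen}_{C^*}(A)=\min(\mathrm{EC}(L_A)),$$ where $L_A=\Delta(A)$ if $A$ is unital and $L_A=\omega\Delta(A)$ (the one-point compactification of $\Delta(A)$) otherwise.
   Context: $\Delta(A)$ is the set of nonzero multiplicative linear functionals on $A$ with the weak$^*$-topology. For a topological space $X$, the density character $d(X)$ is the least cardinality of a dense subset of $X$, and the weight $w(X)$ is the least cardinality of an open base of $X$ ($d(A)$ is taken with respect to the norm topology of $A$). For a nonempty set $S\subseteq A$, $A(S)$ denotes the linear span of all finite products $s_1\cdots s_n$ ($n\ge1$, $s_i\in S$). A nonempty set $S\subseteq A_{sa}=\{a\in A:a=a^*\}$ generates $A$ as a $C^*$-algebra if $\overline{A(S)}=A$ (only generating sets of self-adjoint elements are considered). $\mathrm{gen}_{C^*}(A)$ is the least cardinality of a set generating $A$ as a $C^*$-algebra; $A$ is finitely generated as a $C^*$-algebra if some finite set generates it. For a compact Hausdorff space $K$, $\mathrm{EC}(K)$ is the set of cardinals $\kappa\le|C(K)|$ such that there is an embedding (homeomorphism onto its image) $\Phi\colon K\to\mathbb{R}^\kappa$, where $\mathbb{R}^\kappa$ has the product topology and $|C(K)|$ is the cardinality of the set of continuous complex functions on $K$. *)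

(* Defs.v *)
From HB Require Import structures.
From mathcomp Require Import all_boot all_order all_algebra complex.
From mathcomp Require Import all_classical all_reals all_analysis.

Set Implicit Arguments.
Unset Strict Implicit.
Unset Printing Implicit Defensive.

Import Order.TTheory GRing.Theory Num.Theory.
Import numFieldNormedType.Exports.

Local Open Scope classical_set_scope.
Local Open Scope ring_scope.
Local Open Scope card_scope.

(* Cardinals are represented by types, compared with [#<=] and [#=]: a cardinal
   [k : Type] stands for the cardinality of [[set: k]].  [least_card P k] says
   that k is the least cardinality of a set satisfying P, and that it is
   attained; it determines k up to equipotence. *)
Definition least_card (T : Type) (P : set (set T)) (k : Type) : Prop :=
  (exists2 S, P S & S #= [set: k]) /\ (forall S, P S -> [set: k] #<= S).

Definition is_density (X : topologicalType) (k : Type) : Prop :=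
  least_card [set D : set X | dense D] k.

Definition is_weight (X : topologicalType) (k : Type) : Prop :=
  least_card [set B : set (set X) | basis B] k.

Definition homeomorphism (X Y : topologicalType) (h : X -> Y) : Prop :=
  continuous h /\ exists g, [/\ continuous g, cancel h g & cancel g h].

Definition topological_embedding (X Y : topologicalType) (f : X -> Y) : Prop :=
  exists h : X -> set_type (range f),
    homeomorphism h /\ forall x, set_val (h x) = f x.

(* [R[i]] carries its usual topology through the alias [R[i]^o]. *)
Definition EC (R : realType) (K : topologicalType) (k : Type) : Prop :=
  [set: k] #<= [set: continuousType K R[i]^o] /\
  exists Phi : K -> {ptws k -> R}, topological_embedding Phi.

Definition is_min_EC (R : realType) (K : topologicalType) (k : Type) : Prop :=
  EC R K k /\ forall j : Type, EC R K j -> [set: k] #<= [set: j].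

(* C*-algebras are not assumed unital, so the product is not that of a
   ring structure (these are all unital).  The norm takes values in the
   nonnegative reals of [R[i]]. *)
HB.mixin Record isCStarAlgebra (R : realType) A
    & CompleteNormedModule R[i] A := {
  cmul : A -> A -> A;
  cstar : A -> A;
  cmulA : associative cmul;
  cmulDl : forall a b c : A, cmul (a + b) c = cmul a c + cmul b c;
  cmulDr : forall a b c : A, cmul a (b + c) = cmul a b + cmul a c;
  cscalerAl : forall (l : R[i]) (a b : A), cmul (l *: a) b = l *: cmul a b;
  cscalerAr : forall (l : R[i]) (a b : A), cmul a (l *: b) = l *: cmul a b;
  cnormM : forall a b : A, `|cmul a b| <= `|a| * `|b|;
  cstarK : involutive cstar;
  cstarD : forall a b : A, cstar (a + b) = cstar a + cstar b;
  cstarZ : forall (l : R[i]) (a : A), cstar (l *: a) = l^* *: cstar a;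
  cstarM : forall a b : A, cstar (cmul a b) = cmul (cstar b) (cstar a);
  cstar_norm : forall a : A, `|cmul (cstar a) a| = `|a| ^+ 2
}.

#[short(type="cstarAlgType")]
HB.structure Definition CStarAlgebra (R : realType) :=
  {A of CompleteNormedModule R[i] A & isCStarAlgebra R A}.

Section CStarAlgebraDefs.
Variables (R : realType) (A : cstarAlgType R).

Definition abelian_alg : Prop := commutative (@cmul R A).

Definition unital : Prop := exists e : A, forall a, cmul e a = a /\ cmul a e = a.

Definition self_adjoint : set A := [set a | cstar a = a].

Definition products (S : set A) : set A :=
  [set p | exists (s : A) (t : seq A),
     [/\ S s, (forall x, x \in t -> S x) & p = foldl cmul s t]].

Definition linear_span (E : set A) : set A :=
  [set x | exists (n : nat) (c : 'I_n -> R[i]) (e : 'I_n -> A),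
     (forall i, E (e i)) /\ x = \sum_(i < n) c i *: e i].

Definition generates (S : set A) : Prop :=
  [/\ S !=set0, S `<=` self_adjoint
    & closure (linear_span (products S)) = [set: A]].

Definition finitely_generated : Prop :=
  exists S : set A, finite_set S /\ generates S.

Definition is_gen (k : Type) : Prop := least_card [set S | generates S] k.

(* The topology on the functions [A -> R[i]] is that of pointwise convergence,
   so the subspace topology on [Delta] is the weak* topology.  Boundedness is
   not required: it is automatic for multiplicative linear functionals. *)
Definition characters : set {ptws A -> R[i]^o} :=
  [set phi | [/\ scalar phi,
                 (forall a b, phi (cmul a b) = phi a * phi b)
               & exists a, phi a != 0]].

Definition Delta : topologicalType := set_type characters.

Definition LA : topologicalType :=
  if pselect unital then Delta else one_point_compactification Delta.

End CStarAlgebraDefs.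

(* Main.v *)
Require Import Defs.
From mathcomp Require Import all_boot all_order all_algebra complex.
From mathcomp Require Import all_classical all_reals all_analysis.
From mathcomp Require Import ring lra.

Set Implicit Arguments.
Unset Strict Implicit.
Unset Printing Implicit Defensive.

Import Order.TTheory GRing.Theory Num.Theory.
Import numFieldNormedType.Exports.

Local Open Scope classical_set_scope.
Local Open Scope ring_scope.
Local Open Scope card_scope.

(** The cardinals are compared along the cycle gen <= w <= d <= gen, and gen is
    then identified with the minimum of EC.

    Everything rests on two facts about the compact space K of characters
    together with the zero functional.  First, a set of self-adjoint elements
    that separates the points of K generates the algebra
    ([separating_generates]).  Secondly, every continuous real function on K
    that vanishes at zero is the Gelfand transform of a self-adjoint element
    ([gelfand_surjective]).  Both follow from the Stone-Weierstrass theorem on K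
    and the fact that the Gelfand transform is isometric.

    - gen <= w: choose, for each pair of basic open sets, an element whose values
      on the two sets are distinct ([ex_generates_of_basis]).
    - w <= d: for d in a dense set, the open sets of characters with
      |phi d| > 1/2 form a base ([ex_basis_of_dense]).
    - d <= gen: combinations of products of generators with complex rational
      coefficients are dense ([ex_dense_of_generates]).
    - Evaluation at the generators embeds LA into a power of the line
      ([EC_of_generates]).  Conversely, the coordinates of any embedding, made
      to vanish at infinity, are transforms of elements that generate the algebra
      together with the unit, if there is one ([generates_of_embedding]).

    Since the algebra is not finitely generated, all index sets involved are
    infinite, and a set is equipotent with the set of words over it when it is
    infinite ([card_seq_le]).  The least cardinality of a generating set exists
    because cardinals are well-founded ([ex_least_card]).

    That the transform is isometric ([ex_norming_character]) is shown without
    spectral theory.  In an abelian C*-algebra the norm satisfies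
    |x x| = |x|^2.  Given a of norm 1, Zorn's lemma yields a minimal seminorm
    among those below the norm that are exact on squares and invariant under
    multiplication by a; comparing it with its localizations
    lim p(y x^n) / p(x)^n shows that it is multiplicative.  Ostrowski's proof of
    the Gelfand-Mazur theorem turns it into a character phi with |phi a| = 1.
    Conversely, a Neumann series bounds every character by the norm
    ([char_bound]), and the same argument applied to x |-> (a + i t) x shows that
    characters are real on self-adjoint elements ([char_real]). *)

(** * Cardinal arithmetic *)

Lemma card_le_injP (T U : Type) :
  [set: T] #<= [set: U] <-> exists f : T -> U, injective f.
Proof.
split=> [/card_leP[f]|[f inj_f]].
  pose g (x : T) : U := val (f (SigSub (mem_set (I : [set: T] x)))).
  exists g => x y /val_inj e.
  by have [] := @inj _ _ _ f _ _ (in_setT _) (in_setT _) e.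
have := @inj_card_eq T U setT f (in2W inj_f); rewrite card_eq_le => /andP[_ h].
exact: card_le_trans h (card_leT _).
Qed.

Lemma card_set_type (T : Type) (S : set T) : [set: set_type S] #= S.
Proof. exact: card_setT. Qed.

(** A maximal set of choice functions that is injective in each coordinate
    must be onto in some coordinate [i], as a choice function avoiding all its
    projections could be added; composing the inverse of the [i]-th projection
    with the others embeds [F i] into every [F j]. *)
Lemma ex_least_card (I : Type) (F : I -> Type) (i0 : I) :
  exists i, forall j, [set: F i] #<= [set: F j].
Proof.
pose P : set (set (forall i, F i)) := [set Z | forall i f g, Z f -> Z g ->
  f i = g i -> f = g].
have [|Z [PZ Zmax]] := @Zorn_bigcup _ P.
  move=> C CP Ctot i f g [X CX Xf] [Y CY Yg]; have [XY|YX] := Ctot _ _ CX CY.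
    by apply: (CP _ CY); [exact: XY|].
  by apply: (CP _ CX); [|exact: YX].
have [[i Zi]|noi] := pselect (exists i, forall x, exists f, Z f /\ f i = x).
  have {Zi}[c cP] := choice Zi.
  exists i => j; apply/card_le_injP; exists (fun x => c x j) => x y cxy.
  have [[Zx <-] [Zy <-]] := (cP x, cP y).
  by rewrite (PZ j _ _ Zx Zy cxy).
have /(_ _)/cid avoid i : exists x, forall f, Z f -> f i <> x.
  apply: contra_notP noi => noavoid; exists i => x.
  apply: contra_notP noavoid => nx; exists x => f Zf fx; apply: nx.
  by exists f.
pose y i := sval (avoid i).
have yP i f : Z f -> f i <> y i by exact: (svalP (avoid i)).
have [] := Zmax (Z `|` [set y]).
  split; first by move=> f; left.
  by move=> /(_ y (or_intror erefl)) Zy; exact: (yP i0 _ Zy).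
move=> i f g [Zf|->] [Zg|->] //.
- exact: PZ.
- by move=> /yP => /(_ Zf).
- by move=> /esym/yP => /(_ Zg).
Qed.

Section SeqCard.
Variable T : Type.
Implicit Types (G : set (seq T * T)) (s : seq T) (X Y : set T).

Let letters G : set T := [set t | exists y, G ([:: t], y)].
Let over X s := s <> [::] /\ all (fun t => `[< X t >]) s.

(** Injections of the words over an alphabet into that alphabet are handled
    through their graphs, so that Zorn's lemma applies to unions; the alphabet
    is recovered from the graph as [letters G].  Words are nonempty because the
    empty graph, which is the union of the empty chain, must qualify. *)
Let word_injection G : Prop :=
  [/\ forall s x s' x', G (s, x) -> G (s', x') -> (s = s') <-> (x = x'),
      forall s x, G (s, x) -> over (letters G) s /\ letters G x
    & forall s, over (letters G) s -> exists x, G (s, x)].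

Let overS X Y s : X `<=` Y -> over X s -> over Y s.
Proof.
move=> XY [s0 sX]; split=> //; apply: sub_all sX => t.
by move=> /asboolP Xt; apply/asboolP/XY.
Qed.

Let word_injection_chain (C : set (set (seq T * T))) :
  C `<=` word_injection -> total_on C subset ->
  word_injection (\bigcup_(G in C) G).
Proof.
move=> CP Ctot.
have lettersS G : C G -> letters G `<=` letters (\bigcup_(G in C) G).
  by move=> CG t [y Gy]; exists y; exists G.
split.
- move=> s x s' x' [G CG Gx] [H CH Hx]; have [GH|HG] := Ctot _ _ CG CH.
    by have [h _ _] := CP _ CH; apply: h => //; exact: GH.
  by have [h _ _] := CP _ CG; apply: h => //; exact: HG.
- move=> s x [G CG Gx]; have [_ /(_ _ _ Gx)[os lx] _] := CP _ CG.
  by split; [exact: overS (lettersS _ CG) os | exact: lettersS lx].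
- move=> s [s0 sX].
  suff [G CG Gs] : exists2 G, C G & over (letters G) s.
    by have [_ _ /(_ _ Gs)[x Gx]] := CP _ CG; exists x; exists G.
  elim: s s0 sX => // t [|u s] IH _ /= /andP[/asboolP[y [G CG Gty]]].
    move=> _; exists G => //; split=> //=.
    by rewrite andbT asboolT //; exists y.
  move=> /IH[//|H CH [_ Hs]]; have [GH|HG] := Ctot _ _ CG CH.
    exists H => //; split=> //; apply/andP; split=> //.
    by apply/asboolP; exists y; exact: GH.
  exists G => //; split=> //; apply/andP; split.
    by apply/asboolP; exists y.
  apply: sub_all Hs => v /asboolP[z Hz]; apply/asboolP; exists z; exact: HG.
Qed.

Let word_injection_extend G Y (h : seq T -> T) :
  word_injection G -> (exists y, Y y) -> (forall y, Y y -> ~ letters G y) ->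
  (forall s, over (letters G `|` Y) s -> Y (h s)) ->
  (forall s s', over (letters G `|` Y) s -> over (letters G `|` Y) s' ->
     h s = h s' -> s = s') ->
  exists G', word_injection G' /\ G `<` G'.
Proof.
move=> [G1 G2 G3] [y0 Yy0] YG hY hinj; set X := letters G in YG hY hinj *.
pose E := [set u : seq T * T |
  [/\ over (X `|` Y) u.1, ~ over X u.1 & u.2 = h u.1]].
have lE : letters (G `|` E) = X `|` Y.
  apply/seteqP; split=> t.
    case=> y [Gy|]; first by left; exists y.
    by case=> -[_ /= /andP[/asboolP]].
  case=> [[y Gy]|Yt]; first by exists y; left.
  exists (h [:: t]); right; split=> //=.
    by split=> //=; rewrite andbT; apply/asboolP; right.
  by move=> [_ /= /andP[/asboolP/(YG _ Yt)]].
exists (G `|` E); split; first split.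
- move=> s x s' x' [Gsx|[/= os nos ->]] [Gs'x'|[/= os' nos' ->]].
  + exact: G1.
  + have [osX Xx] := G2 _ _ Gsx; split=> [e|e].
      by case: nos'; rewrite -e.
    by have /YG[] := hY _ os'; rewrite -e.
  + have [osX Xx] := G2 _ _ Gs'x'; split=> [e|e].
      by case: nos; rewrite e.
    by have /YG[] := hY _ os; rewrite e.
  + by split=> [->|/hinj] //; apply.
- rewrite lE => s x [/G2[os Xx]|[/= os _ ->]].
    by split; [apply: overS os => t; left|left].
  by split=> //; right; exact: hY.
- rewrite lE => s os; have [/G3[x Gx]|nos] := pselect (over X s).
    by exists x; left.
  by exists (h s); right.
split=> [u Gu|]; first by left.
have oy : over (X `|` Y) [:: y0].
  by split=> //=; rewrite andbT; apply/asboolP; right.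
move=> /(_ ([:: y0], h [:: y0])) => /(_ _)/G2[].
  by right; split=> //= -[_ /= /andP[/asboolP/(YG _ Yy0)]].
by move=> _ /YG; apply; exact: hY.
Qed.

(** Zorn's lemma gives a maximal injection of the words over some [X] into
    [X].  If the complement of [X] contained a copy of [X] (or of [nat], when
    [X] is empty), the injection could be extended to the words over the union
    of the two; hence the complement embeds into [X], and [T] itself embeds
    into the words over [X]. *)
Lemma card_seq_le : infinite_set [set: T] -> [set: seq T] #<= [set: T].
Proof.
move=> Tinf; have [t0 _] := infinite_setN0 Tinf.
have /infiniteP/card_le_injP[nu nu_inj] := Tinf.
have [|G [PG Gmax]] := @Zorn_bigcup _ word_injection.
  exact: word_injection_chain.
have noext G' : word_injection G' -> G `<` G' -> False.
  by move=> P' /Gmax; apply.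
set X := letters G; have [G1 G2 G3] := PG.
have [f fP] : {f & forall s, over X s -> G (s, f s)}.
  apply: (@choice _ _ (fun s x => over X s -> G (s, x))) => s.
  by have [/G3[x Gx]|ns] := pselect (over X s); [exists x|exists t0].
have fX s : over X s -> X (f s) by move=> /fP/G2[].
have f_inj s s' : over X s -> over X s' -> f s = f s' -> s = s'.
  by move=> /fP fs /fP fs' /(G1 _ _ _ _ fs fs').
have over1 t : X t -> over X [:: t].
  by move=> Xt; split=> //=; rewrite andbT; apply/asboolP.
have over2 t : X t -> over X [:: t; t].
  by move=> Xt; split=> //=; rewrite andbT andbb; apply/asboolP.
have over_map Z (c : T -> T) s :
    (forall t, Z t -> X (c t)) -> over Z s -> over X (map c s).
  move=> cX [s0 sZ]; split; first by case: s s0 {sZ}.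
  rewrite all_map; apply: sub_all sZ => t /asboolP Zt /=.
  by apply/asboolP/cX.
have map_inj Z (c : T -> T) s s' :
    (forall t t', Z t -> Z t' -> c t = c t' -> t = t') ->
    over Z s -> over Z s' -> map c s = map c s' -> s = s'.
  move=> cinj [_ sZ] [_ s'Z]; elim: s s' sZ s'Z => [|t s IH] [|t' s'] //=.
  move=> /andP[/asboolP Zt sZ] /andP[/asboolP Zt' s'Z] [/cinj-> //].
  by move=> /IH-> .
have [X0|[x0 Xx0]] : X = set0 \/ exists x, X x.
- by have [->|/set0P] := eqVneq X set0; [left|right].
- have Y0 : range nu !=set0 by exists (nu 0%N), 0%N.
  exfalso; pose c (t : T) : nat := xget 0%N [set n | nu n = t].
  have cK t : range nu t -> nu (c t) = t.
    move=> [n _ nt]; rewrite /c.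
    by apply: (@xgetPex _ 0%N [set n | nu n = t]); exists n.
  pose h s := nu (pickle (map c s)).
  have oY s : over (letters G `|` range nu) s -> over (range nu) s.
    by rewrite -/X X0 set0U.
  have [||||G' [PG' GG']] := @word_injection_extend G (range nu) h PG.
  + exact: Y0.
  + by move=> y _; rewrite -/(letters G) -/X X0.
  + by move=> s _; exists (pickle (map c s)).
  + move=> s s' /oY[_ os] /oY[_ os'] /nu_inj /(pcan_inj pickleK) e.
    elim: s s' os os' e => [|t s IH] [|t' s'] //= /andP[/asboolP yt ys].
    move=> /andP[/asboolP yt' ys'] [ett' ess']; congr cons; last exact: IH.
    by rewrite -(cK _ yt) -(cK _ yt') ett'.
  + exact: noext GG'.
have sval_inj (P : T -> Prop) : injective (@sval T P).
  by move=> [x p] [y q] /= xy; exact: eq_exist.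
have [b bP] := @ex_least_card bool
  (fun b => if b then {t | ~ X t} else {t | X t}) true.
case: b bP => [/(_ false)|/(_ true)].
  (* The complement of X embeds into X: a letter of X is encoded by a word of
     length one, any other letter by a word of length two over X. *)
  move=> /card_le_injP[g ginj].
  pose code t := f (if pselect (X t) is right nXt
                    then let y := sval (g (exist _ t nXt)) in [:: y; y]
                    else [:: t]).
  have overg t (nXt : ~ X t) := over2 _ (svalP (g (exist _ t nXt))).
  have codeX t : X (code t).
    rewrite /code; case: pselect => Xt; apply: fX; first exact: over1.
    exact: overg.
  have code_inj t t' : code t = code t' -> t = t'.
    rewrite /code; case: pselect => Xt; case: pselect => Xt'.
    - by move=> /(f_inj _ _ (over1 _ Xt) (over1 _ Xt'))[].
    - by move=> /(f_inj _ _ (over1 _ Xt) (overg _ Xt')).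
    - by move=> /(f_inj _ _ (overg _ Xt) (over1 _ Xt')).
    - by move=> /(f_inj _ _ (overg _ Xt) (overg _ Xt'))[/sval_inj/ginj[]].
  apply/card_le_injP; exists (fun s => f (map code (t0 :: s))) => s s'.
  have oT s1 : over setT (t0 :: s1).
    by split=> //; elim: (t0 :: s1) => //= t s2 ->; rewrite asboolT.
  have om s1 : over X (map code (t0 :: s1)).
    exact: (over_map setT _ _ (fun t _ => codeX t) (oT s1)).
  move=> /f_inj => /(_ (om _) (om _)) e.
  suff [] : t0 :: s = t0 :: s' by [].
  have code_injT t t' (_ _ : True) : code t = code t' -> t = t'.
    exact: code_inj.
  exact: (map_inj setT code _ _ code_injT (oT s) (oT s') e).
(* Otherwise X embeds into its complement, against maximality. *)
move=> /card_le_injP[g ginj]; exfalso.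
pose e t : T := if pselect (X t) is left Xt then sval (g (exist _ t Xt))
                else t.
have eN t : X t -> ~ X (e t).
  move=> Xt; rewrite /e; case: pselect => // Xt'.
  exact: (svalP (g (exist _ t Xt'))).
have e_inj t t' : X t -> X t' -> e t = e t' -> t = t'.
  move=> Xt Xt'; rewrite /e; case: pselect => // Xt1; case: pselect => // Xt2.
  by move=> /sval_inj/ginj[].
pose Y := e @` X.
have [d dP] : {d & forall t, Y t -> X (d t) /\ e (d t) = t}.
  apply: (@choice _ _ (fun t x => Y t -> X x /\ e x = t)) => t.
  by have [[x Xx ex]|nY] := pselect (Y t); [exists x|exists x0 => /nY].
pose code t := f (if pselect (X t) then [:: t] else [:: d t; d t]).
have codeX t : (X `|` Y) t -> X (code t).
  move=> XYt; rewrite /code; apply: fX; case: pselect => Xt; first exact: over1.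
  by apply: over2; case: XYt => // /dP[].
have code_inj t t' : (X `|` Y) t -> (X `|` Y) t' -> code t = code t' -> t = t'.
  move=> XYt XYt'; rewrite /code; case: pselect => Xt; case: pselect => Xt'.
  - by move=> /f_inj => /(_ (over1 _ Xt) (over1 _ Xt'))[].
  - case: XYt' => // /dP[Xd _].
    by move=> /f_inj => /(_ (over1 _ Xt) (over2 _ Xd)).
  - case: XYt => // /dP[Xd _].
    by move=> /f_inj => /(_ (over2 _ Xd) (over1 _ Xt')).
  - case: XYt => // /dP[Xd ed]; case: XYt' => // /dP[Xd' ed'].
    move=> /f_inj => /(_ (over2 _ Xd) (over2 _ Xd'))[dd _].
    by rewrite -ed -ed' dd.
pose h s := e (f (map code s)).
have oh s : over (X `|` Y) s -> over X (map code s) by exact: over_map.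
have [||||G' [PG' GG']] := @word_injection_extend G Y h PG.
- by exists (e x0); exists x0.
- by move=> _ [x Xx <-]; exact: eN.
- by move=> s /oh/fX Xs; exists (f (map code s)).
- move=> s s' os os' /e_inj => /(_ (fX _ (oh _ os)) (fX _ (oh _ os'))).
  move=> /f_inj => /(_ (oh _ os) (oh _ os')).
  exact: map_inj code_inj os os'.
- exact: noext GG'.
Qed.

End SeqCard.

(** * Real-valued norms and complex discs *)

Local Open Scope complex_scope.

Section RealNorm.
Variable R : realType.

(** The norm as a real number: the norms of the modules at hand take their
    values in the nonnegative elements of [R[i]]. *)
Definition nrm (V : normedZmodType R[i]) (x : V) : R := complex.Re `|x|.

Lemma normE (V : normedZmodType R[i]) (x : V) : `|x| = (nrm x)%:C.
Proof.
rewrite /nrm; have := normr_ge0 x; rewrite lecE => /andP[/eqP].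
by case: `|x| => a b /= ->.
Qed.

Section Zmodule.
Variable V : normedZmodType R[i].
Implicit Types x y z : V.

Lemma nrm_ge0 x : 0 <= nrm x.
Proof. by rewrite -lecR -normE normr_ge0. Qed.

Lemma nrmD x y : nrm (x + y) <= nrm x + nrm y.
Proof. by rewrite -lecR rmorphD /= -!normE ler_normD. Qed.

Lemma nrmN x : nrm (- x) = nrm x.
Proof. by rewrite /nrm normrN. Qed.

Lemma nrm_distC x y : nrm (x - y) = nrm (y - x).
Proof. by rewrite -nrmN opprB. Qed.

Lemma nrm0 : nrm (0 : V) = 0.
Proof. by rewrite /nrm normr0. Qed.

Lemma nrm_eq0 x : (nrm x == 0) = (x == 0).
Proof. by rewrite -[RHS]normr_eq0 normE -(inj_eq (@complexI _)). Qed.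

Lemma nrm_gt0 x : (0 < nrm x) = (x != 0).
Proof. by rewrite lt_def nrm_ge0 andbT nrm_eq0. Qed.

Lemma nrm_triangle z x y : nrm (x - y) <= nrm (x - z) + nrm (z - y).
Proof. by rewrite -{1}(subrK z x) -addrA nrmD. Qed.

End Zmodule.

Lemma nrmCM (k l : R[i]) : nrm (k * l) = nrm k * nrm l.
Proof. by apply: (@complexI R); rewrite rmorphM /= -!normE normrM. Qed.

Lemma nrmCR (x : R) : nrm (x%:C) = `|x|.
Proof. by rewrite /nrm normc_def /= expr0n /= addr0 sqrtr_sqr. Qed.

Lemma nrmC1 : nrm (1 : R[i]) = 1.
Proof. by rewrite -[1]/(1%:C) nrmCR normr1. Qed.

Lemma nrmCV (k : R[i]) : nrm k^-1 = (nrm k)^-1.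
Proof.
have [->|k0] := eqVneq k 0; first by rewrite invr0 nrm0 invr0.
have nk0 : nrm k != 0 by rewrite nrm_eq0.
by apply: (mulfI nk0); rewrite -nrmCM !mulfV // nrmC1.
Qed.

Lemma nrmCX (k : R[i]) n : nrm (k ^+ n) = nrm k ^+ n.
Proof. by elim: n => [|n IH]; rewrite ?nrmC1 // !exprS nrmCM IH. Qed.

Lemma nrmC_sqr (z : R[i]) : nrm z ^+ 2 = complex.Re z ^+ 2 + complex.Im z ^+ 2.
Proof. by rewrite /nrm normc_def /= sqr_sqrtr // addr_ge0 ?sqr_ge0. Qed.

Lemma nrmC_Re (z : R[i]) : `|complex.Re z| <= nrm z.
Proof.
rewrite -(@ler_pXn2r _ 2) ?nnegrE ?nrm_ge0 // real_normK ?num_real //.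
by rewrite nrmC_sqr lerDl sqr_ge0.
Qed.

Lemma nrmC_Im (z : R[i]) : `|complex.Im z| <= nrm z.
Proof.
rewrite -(@ler_pXn2r _ 2) ?nnegrE ?nrm_ge0 // real_normK ?num_real //.
by rewrite nrmC_sqr lerDr sqr_ge0.
Qed.

Lemma nrmC_le (z : R[i]) : nrm z <= `|complex.Re z| + `|complex.Im z|.
Proof.
case: z => a b /=; rewrite -(@ler_pXn2r _ 2) ?nnegrE ?nrm_ge0 ?addr_ge0 //.
rewrite nrmC_sqr /= sqrrD !real_normK ?num_real // lerD2r lerDl.
by rewrite mulrn_wge0 // mulr_ge0.
Qed.

Section Module.
Variable V : normedModType R[i].
Implicit Types x y : V.

Lemma nrmZ (l : R[i]) x : nrm (l *: x) = nrm l * nrm x.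
Proof. by apply: (@complexI R); rewrite rmorphM /= -!normE normrZ. Qed.

Lemma nbhs_nrmP x (U : set V) :
  nbhs x U <-> exists2 e : R, 0 < e & forall y, nrm (x - y) < e -> U y.
Proof.
split=> [/nbhs_normP[e /= e0 eU]|[e e0 eU]].
  have ee : e = (complex.Re e)%:C.
    by move: e0; rewrite ltcE => /andP[/eqP]; case: (e) => a b /= ->.
  exists (complex.Re e); first by rewrite -ltcR -ee.
  by move=> y ye; apply: eU; rewrite /= normE ee ltcR.
apply/nbhs_normP; exists e%:C => /=; first by rewrite ltcR.
by move=> y; rewrite /= normE ltcR; exact: eU.
Qed.

Lemma nbhs_nrm x (e : R) : 0 < e -> nbhs x [set y | nrm (x - y) < e].
Proof. by move=> e0; apply/nbhs_nrmP; exists e. Qed.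

Lemma cvg_nrmP (T : Type) (F : set_system T) (FF : Filter F) (f : T -> V) x :
  f @ F --> x <-> forall e : R, 0 < e -> \forall t \near F, nrm (x - f t) < e.
Proof.
split=> [fx e e0|fx U /nbhs_nrmP[e e0 eU]].
  by apply: (fx [set y | nrm (x - y) < e]); exact: nbhs_nrm.
by apply: filterS (fx e e0) => t; exact: eU.
Qed.

Lemma lipschitz_continuous (f : V -> R) (C : R) :
  (forall x y, f x - f y <= C * nrm (x - y)) -> continuous f.
Proof.
move=> fC x; apply/cvgrPdist_lt => e e0.
have C0 : 0 < Num.max C 1 by rewrite lt_max ltr01 orbT.
apply/nbhs_nrmP; exists (e / Num.max C 1); first by rewrite divr_gt0.
move=> y; rewrite /= ltr_pdivlMr // => xy.
have xy' : C * nrm (x - y) < e.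
  by apply: le_lt_trans xy; rewrite mulrC ler_wpM2l ?nrm_ge0 // le_max lexx.
rewrite ltr_norml; apply/andP; split; last exact: le_lt_trans (fC x y) _.
by rewrite ltrNl opprB (le_lt_trans (fC y x)) // nrm_distC.
Qed.

End Module.

Lemma continuous_nrm (V : normedModType R[i]) : continuous (@nrm V : V -> R).
Proof.
apply: (@lipschitz_continuous V _ 1) => x y.
by rewrite mul1r lerBlDr -{1}(subrK y x) nrmD.
Qed.

Lemma continuous_Re : continuous (fun z : R[i]^o => complex.Re z).
Proof.
apply: (@lipschitz_continuous _ _ 1) => x y; rewrite mul1r.
apply: le_trans (nrmC_Re (x - y)).
by case: x y => a b [c d] /=; exact: ler_norm.
Qed.

Lemma compact_square (M : R) :
  compact ([set z | `|complex.Re z| <= M /\ `|complex.Im z| <= M] : set R[i]^o).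
Proof.
pose f (u : R * R) : R[i]^o := (u.1 +i* u.2)%C.
have -> : [set z | `|complex.Re z| <= M /\ `|complex.Im z| <= M]
    = f @` (`[- M, M]%classic `*` `[- M, M]%classic).
  apply/seteqP; split=> [[a b] /= [aM bM]|_ [[a b] /= [aM bM] <-]] /=.
    by exists (a, b) => //; split; rewrite /= in_itv /= -ler_norml.
  by move: aM bM; rewrite !in_itv /= -!ler_norml.
apply: continuous_compact; last first.
  by apply: compact_setX; exact: segment_compact.
apply: continuous_subspaceT => -[a b]; apply/cvg_nrmP => e e0.
have e2 : 0 < e / 2 by rewrite divr_gt0.
near=> u; rewrite /f /=.
apply: le_lt_trans (nrmC_le _) _; rewrite /= (splitr e) ltrD //.
  near: u; have : (fun u : R * R => u.1) @ nbhs (a, b) --> a by exact: cvg_fst.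
  by move=> /cvgrPdist_lt; apply.
near: u; have : (fun u : R * R => u.2) @ nbhs (a, b) --> b by exact: cvg_snd.
by move=> /cvgrPdist_lt; apply.
Unshelve. all: by end_near. Qed.

Lemma compact_disc (M : R) : compact ([set z | nrm z <= M] : set R[i]^o).
Proof.
apply: subclosed_compact (@compact_square M) _; last first.
  by move=> z zM; split; apply: le_trans zM; rewrite ?nrmC_Re ?nrmC_Im.
have := @continuous_nrm R[i]^o; rewrite continuous_closedP.
by move=> /(_ _ (@closed_le R M)).
Qed.

End RealNorm.

(** * Multiplicative seminorms on an abelian C*-algebra *)

Local Notation "x ** y" := (cmul x y) (at level 40, left associativity).

Lemma ge0_eqVlt (R : numDomainType) (t : R) : 0 <= t -> t = 0 \/ 0 < t.
Proof. by rewrite le_eqVlt => /orP[/eqP|]; [left|right]. Qed.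

Section CStarBasics.
Variables (R : realType) (A : cstarAlgType R).
Implicit Types (a b x y z : A) (l : R[i]).

Lemma cmul0r x : 0 ** x = 0.
Proof. by rewrite -(scale0r (0 : A)) cscalerAl !scale0r. Qed.

Lemma cmulr0 x : x ** 0 = 0.
Proof. by rewrite -(scale0r (0 : A)) cscalerAr !scale0r. Qed.

Lemma cmulNr x y : (- x) ** y = - (x ** y).
Proof. by apply/eqP; rewrite -subr_eq0 opprK -cmulDl addNr cmul0r. Qed.

Lemma cmulrN x y : x ** (- y) = - (x ** y).
Proof. by apply/eqP; rewrite -subr_eq0 opprK -cmulDr addNr cmulr0. Qed.

Lemma cmulBr x y z : x ** (y - z) = x ** y - x ** z.
Proof. by rewrite cmulDr cmulrN. Qed.

Lemma nrmM x y : nrm (x ** y) <= nrm x * nrm y.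
Proof. by rewrite -lecR rmorphM /= -!normE cnormM. Qed.

Lemma nrm_starM x : nrm (cstar x ** x) = nrm x ^+ 2.
Proof. by apply: (@complexI R); rewrite rmorphXn /= -!normE cstar_norm. Qed.

Lemma nrm_star x : nrm (cstar x) = nrm x.
Proof.
have le y : nrm y <= nrm (cstar y).
  have [->|y0] := eqVneq y 0; first by rewrite nrm0 nrm_ge0.
  have ny : 0 < nrm y by rewrite nrm_gt0.
  by rewrite -(ler_pM2r ny) -expr2 -nrm_starM nrmM.
by apply/le_anti; rewrite le andbT -{2}(cstarK x) le.
Qed.

End CStarBasics.

Section MultiplicativeSeminorm.
Variables (R : realType) (A : cstarAlgType R) (abelA : abelian_alg A).
Implicit Types (a b x y z : A) (l : R[i]) (p q : A -> R).

Let cmulC x y : x ** y = y ** x. Proof. exact: abelA. Qed.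
Let cmulAC x y z : x ** y ** z = x ** z ** y.
Proof. by rewrite -!cmulA (cmulC y). Qed.
Let cmulACA x y z t : x ** y ** (z ** t) = x ** z ** (y ** t).
Proof. by rewrite !cmulA (cmulAC x). Qed.

(** Elements of an abelian C*-algebra are normal, so that the C*-identity
    extends from [x^* x] to [x x]. *)
Lemma nrm_sqr x : nrm (x ** x) = nrm x ^+ 2.
Proof.
apply/eqP; rewrite -(@eqrXn2 _ 2) ?sqr_ge0 ?nrm_ge0 // -!nrm_starM.
by rewrite !cstarM cstarK cmulACA.
Qed.

(** Exactness on squares passes to the infima considered below, and is what
    makes the localization at [x] keep the value at [x]. *)
Definition square_seminorm p := [/\
  forall x, 0 <= p x <= nrm x,
  forall x y, p (x + y) <= p x + p y,
  forall l x, p (l *: x) = nrm l * p x,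
  forall x y, p (x ** y) <= p x * p y &
  forall x, p (x ** x) = p x ^+ 2].

Lemma nrm_square_seminorm : square_seminorm (fun x => nrm x).
Proof.
split=> [x|x y|l x|x y|x]; rewrite ?nrm_ge0 ?lexx ?nrmD ?nrmZ ?nrmM //.
exact: nrm_sqr.
Qed.

Section InfimumSeminorm.
Variables (I : Type) (i0 : I) (q : I -> A -> R).
Hypothesis q_bound : forall i x, 0 <= q i x <= nrm x.
Hypothesis qD : forall i x y, q i (x + y) <= q i x + q i y.
Hypothesis qZ : forall i l x, q i (l *: x) = nrm l * q i x.
Hypothesis q_directed :
  forall i j, exists k, forall x, q k x <= q i x /\ q k x <= q j x.
Hypothesis qM : forall i, exists k, forall x y, q k (x ** y) <= q i x * q i y.
Hypothesis q_sqr : forall i x, exists k, q k x ^+ 2 <= q i (x ** x).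

Definition inf_seminorm x := inf (range (q^~ x)).

Let q_ge0 i x : 0 <= q i x. Proof. by case/andP: (q_bound i x). Qed.

Lemma inf_seminorm_le i x : inf_seminorm x <= q i x.
Proof. by apply: ge_inf; [exists 0 => _ [j _ <-]; exact: q_ge0|exists i]. Qed.

Lemma le_inf_seminorm c x : (forall i, c <= q i x) -> c <= inf_seminorm x.
Proof.
move=> cq; apply: lb_le_inf; first by exists (q i0 x); exists i0.
by move=> _ [j _ <-].
Qed.

Let inf_ge0 x : 0 <= inf_seminorm x.
Proof. by apply: le_inf_seminorm => i. Qed.

(** The infimum of a directed family is needed twice: for a chain of seminorms
    (with [k = i] in the last two hypotheses) and for a sequence whose terms are
    multiplicative only up to doubling the index. *)
Lemma inf_square_seminorm : square_seminorm inf_seminorm.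
Proof.
have infM x y : inf_seminorm (x ** y) <= inf_seminorm x * inf_seminorm y.
  have bound i : inf_seminorm (x ** y) <= q i x * q i y.
    have [k qk] := qM i.
    exact: le_trans (inf_seminorm_le k _) (qk x y).
  have bound2 i j : inf_seminorm (x ** y) <= q i x * q j y.
    have [k qk] := q_directed i j; apply: le_trans (bound k) _.
    by apply: ler_pM => //; case: (qk x) (qk y) => ? _ [].
  have bound1 i : inf_seminorm (x ** y) <= q i x * inf_seminorm y.
    have [qi0|qi_gt0] := ge0_eqVlt (q_ge0 i x).
      by apply: le_trans (bound2 i i0) _; rewrite qi0 !mul0r.
    rewrite -ler_pdivrMl //; apply: le_inf_seminorm => j.
    by rewrite ler_pdivrMl.
  have [y0|y_gt0] := ge0_eqVlt (inf_ge0 y).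
    by apply: le_trans (bound1 i0) _; rewrite y0 !mulr0.
  rewrite -ler_pdivrMr //; apply: le_inf_seminorm => i.
  by rewrite ler_pdivrMr.
split=> //.
- move=> x; rewrite inf_ge0 /=.
  by apply: le_trans (inf_seminorm_le i0 x) _; case/andP: (q_bound i0 x).
- move=> x y; have bound i j : inf_seminorm (x + y) <= q i x + q j y.
    have [k qk] := q_directed i j; apply: le_trans (inf_seminorm_le k _) _.
    by apply: le_trans (qD _ _ _) _; apply: lerD; case: (qk x) (qk y) => ? _ [].
  rewrite -lerBlDr; apply: le_inf_seminorm => i.
  rewrite lerBlDr -lerBlDl; apply: le_inf_seminorm => j.
  by rewrite lerBlDl.
- move=> l x; apply/le_anti/andP; split; last first.
    apply: le_inf_seminorm => i.
    by rewrite qZ ler_wpM2l ?nrm_ge0 ?inf_seminorm_le.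
  have [l0|l_gt0] := ge0_eqVlt (nrm_ge0 l).
    by apply: le_trans (inf_seminorm_le i0 _) _; rewrite qZ l0 !mul0r.
  rewrite -ler_pdivrMl //; apply: le_inf_seminorm => i.
  by rewrite ler_pdivrMl // -qZ inf_seminorm_le.
- move=> x; apply/le_anti/andP; split; first by rewrite expr2 infM.
  apply: le_inf_seminorm => i; have [k qk] := q_sqr i x.
  by apply: le_trans qk; rewrite ler_pXn2r ?nnegrE ?inf_seminorm_le.
Qed.

End InfimumSeminorm.

Section Localization.
Variables (p : A -> R) (x : A).
Hypotheses (pP : square_seminorm p) (px_gt0 : 0 < p x).

Let p_bound y : 0 <= p y <= nrm y. Proof. by case: pP. Qed.
Let p_ge0 y : 0 <= p y. Proof. by case/andP: (p_bound y). Qed.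
Let pD y z : p (y + z) <= p y + p z. Proof. by case: pP. Qed.
Let pZ l y : p (l *: y) = nrm l * p y. Proof. by case: pP. Qed.
Let pM y z : p (y ** z) <= p y * p z. Proof. by case: pP. Qed.
Let p_sqr y : p (y ** y) = p y ^+ 2. Proof. by case: pP. Qed.

Let mulX n y := iter n (fun z => z ** x) y.

Let mulXM m n y z : mulX (m + n) (y ** z) = mulX m y ** mulX n z.
Proof.
elim: m => [|m IH] /=; last by rewrite IH cmulAC.
by elim: n => [|n IH] //=; rewrite IH cmulA.
Qed.

Let mulXD n y z : mulX n (y + z) = mulX n y + mulX n z.
Proof. by elim: n => [|n IH] //=; rewrite IH cmulDl. Qed.

Let mulXZ n l y : mulX n (l *: y) = l *: mulX n y.
Proof. by elim: n => [|n IH] //=; rewrite IH cscalerAl. Qed.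

Let q n y := p (mulX n y) / p x ^+ n.

Let pxn n : 0 < p x ^+ n. Proof. by rewrite exprn_gt0. Qed.

Let q_decr m n y : (m <= n)%N -> q n y <= q m y.
Proof.
move=> /subnK <-; elim: (n - m)%N => // k IH; apply: le_trans IH.
rewrite addSn /q /= exprS invfM mulrA ler_pM2r ?invr_gt0 //.
by rewrite ler_pdivrMr.
Qed.

(** The limit of the decreasing sequence [p (y x^n) / p x ^ n]. *)
Definition localized_seminorm := inf_seminorm q.

Lemma localized_square_seminorm : square_seminorm localized_seminorm.
Proof.
have qn_ge0 n y : 0 <= q n y by rewrite divr_ge0 // ltW.
apply: (inf_square_seminorm (0%N)).
- move=> n y; rewrite qn_ge0 /=; apply: le_trans (q_decr _ (leq0n n)) _.
  by rewrite /q expr0 divr1; case/andP: (p_bound y).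
- by move=> n y z; rewrite /q mulXD -mulrDl ler_pM2r ?invr_gt0.
- by move=> n l y; rewrite /q mulXZ pZ mulrA.
- by move=> m n; exists (maxn m n) => y; rewrite !q_decr ?leq_maxl ?leq_maxr.
- move=> n; exists (n + n)%N => y z.
  by rewrite /q mulXM exprD invfM mulrACA ler_pM2r ?mulr_gt0 ?invr_gt0.
- move=> n y; exists n; apply: le_trans (q_decr _ (leq_addr n n)).
  by rewrite /q mulXM p_sqr exprD invfM exprMn -expr2.
Qed.

Lemma localized_le y : localized_seminorm y <= p y.
Proof.
apply: le_trans (inf_seminorm_le _ 0%N _) _; last by rewrite /q expr0 divr1.
move=> n z; rewrite divr_ge0 ?(ltW (pxn n)) //=.
apply: le_trans (q_decr _ (leq0n n)) _.
by rewrite /q expr0 divr1; case/andP: (p_bound z).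
Qed.

Lemma localized_mul y :
  localized_seminorm (x ** y) = p x * localized_seminorm y.
Proof.
have qx n : q n (x ** y) = p x * q n.+1 y.
  have -> : q n (x ** y) = p (mulX n.+1 y) / p x ^+ n.
    by rewrite /q cmulC /mulX -iterSr.
  by rewrite /q exprS invfM (mulrCA (p x)) (mulrA (p x)) divff ?gt_eqF // mul1r.
have qn_bound n z : 0 <= q n z <= nrm z.
  rewrite divr_ge0 ?(ltW (pxn n)) //=; apply: le_trans (q_decr _ (leq0n n)) _.
  by rewrite /q expr0 divr1; case/andP: (p_bound z).
apply/le_anti/andP; split.
  rewrite -ler_pdivrMl //; apply: (le_inf_seminorm 0%N) => n.
  rewrite ler_pdivrMl //; apply: le_trans (inf_seminorm_le qn_bound n _) _.
  by rewrite qx ler_pM2l // q_decr.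
apply: (le_inf_seminorm 0%N) => n; rewrite qx ler_pM2l //.
exact: inf_seminorm_le.
Qed.

Lemma localized_invariant a :
  (forall y, p (a ** y) = p y) ->
  forall y, localized_seminorm (a ** y) = localized_seminorm y.
Proof.
move=> pa y; rewrite /localized_seminorm /inf_seminorm.
suff -> : q^~ (a ** y) = q^~ y by [].
apply/funext => n; rewrite /q.
have -> : mulX n (a ** y) = a ** mulX n y.
  by elim: n => //= n ->; rewrite cmulA.
by rewrite pa.
Qed.

(** Exactness on squares gives [p (x^m) = p x ^ m] when [m] is a power of two,
    and the sequence defining the localization at [x] is decreasing. *)
Lemma localized_self : localized_seminorm x = p x.
Proof.
apply/le_anti; rewrite localized_le /=; apply: (le_inf_seminorm 0%N) => n.
suff [m nm <-] : exists2 m, (n <= m)%N & q m x = p x by exact: q_decr.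
elim: n => [|n [m nm qm]]; first by exists 0%N => //; rewrite /q expr0 divr1.
exists (m + m).+1; first by rewrite ltnS (leq_trans nm) // leq_addr.
have pm : p (mulX m x) = p x ^+ m.+1.
  move/(congr1 ( *%R^~ (p x ^+ m))): qm.
  by rewrite /q /= divfK ?gt_eqF // -exprS.
rewrite /q; have -> : mulX (m + m).+1 x = mulX m x ** mulX m x.
  by rewrite -mulXM /mulX iterSr.
rewrite p_sqr pm -exprM muln2 -addnn addSn addnS exprS.
by rewrite mulfK ?gt_eqF.
Qed.

End Localization.

(** Among the seminorms that are invariant under multiplication by [a], a
    minimal one coincides with its localization at each [x] where it does not
    vanish, and is therefore multiplicative.  Invariance, which is acquired by
    localizing the norm at [a], keeps the value at [a] equal to [1]. *)
Lemma ex_multiplicative_seminorm a : nrm a = 1 ->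
  exists p, [/\ square_seminorm p, p a = 1 &
    forall x y, p (x ** y) = p x * p y].
Proof.
move=> a1.
pose N p := [/\ square_seminorm p, p a = 1 & forall y, p (a ** y) = p y].
have N_localized p x : N p -> 0 < p x -> N (localized_seminorm p x).
  move=> [pP pa1 pa] px; have La := localized_invariant x pa.
  split=> //; first exact: localized_square_seminorm.
  have := localized_mul pP px a; rewrite cmulC La localized_self //.
  by move=> e; apply: (@mulfI _ (p x)); rewrite ?gt_eqF // -e mulr1.
have N0 : N (localized_seminorm (fun x => nrm x) a).
  have a0 : 0 < nrm a by rewrite a1.
  have nP := nrm_square_seminorm.
  split; first exact: (localized_square_seminorm nP).
    by rewrite (localized_self nP).
  by move=> y; rewrite (localized_mul nP) // a1 mul1r.
pose T := {p | N p}; pose t0 : T := exist _ _ N0.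
pose below (s t : T) := `[< forall y, sval t y <= sval s y >].
have [||||[p Np] pmin] := @Zorn T below.
- by move=> t; apply/asboolP.
- move=> r s t /asboolP rs /asboolP st; apply/asboolP => y.
  exact: le_trans (st y) (rs y).
- move=> [s Ns] [t Nt] /asboolP /= st /asboolP /= ts; apply: eq_exist.
  by apply/funext => y; apply/le_anti; rewrite st ts.
- move=> C Ctot; have [[c0 Cc0]|C0] := pselect (exists c, C c); last first.
    by exists t0 => s Cs; case: C0; exists s.
  pose J := {t | C t}; pose q (j : J) := sval (sval j).
  have j0 : J by exists c0.
  have qP (j : J) : N (q j) := svalP (sval j).
  have q_bound j y : 0 <= q j y <= nrm y by case: (qP j) => -[].
  have NI : N (inf_seminorm q).
    split.
    + apply: (inf_square_seminorm j0) => //.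
      * by move=> i; case: (qP i) => -[].
      * by move=> i; case: (qP i) => -[].
      * move=> [s Cs] [t Ct]; have [/asboolP st|/asboolP ts] := Ctot _ _ Cs Ct.
          by exists (exist _ t Ct) => y; rewrite lexx st.
        by exists (exist _ s Cs) => y; rewrite lexx ts.
      * by move=> i; exists i; case: (qP i) => -[].
      * move=> i y; exists i; suff -> : q i (y ** y) = q i y ^+ 2 by [].
        by case: (qP i) => -[].
    + apply/le_anti; rewrite (le_inf_seminorm j0) => [|i]; last first.
        by case: (qP i) => _ ->.
      rewrite andbT; apply: le_trans (inf_seminorm_le q_bound j0 _) _.
      by case: (qP j0) => _ ->.
    + move=> y; rewrite /inf_seminorm.
      suff -> : q^~ (a ** y) = q^~ y by [].
      by apply/funext => i; case: (qP i) => _ _ ->.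
  exists (exist _ _ NI) => s Cs; apply/asboolP => y /=.
  exact: (inf_seminorm_le q_bound (exist _ s Cs : J)).
exists p; have [pP pa1 pa] := Np; split=> // x y.
have [p_bound _ _ pM _] := pP.
have p_ge0 z : 0 <= p z by case/andP: (p_bound z).
have [px0|px_gt0] := ge0_eqVlt (p_ge0 x).
  by apply/le_anti; rewrite pM px0 mul0r p_ge0.
have NL := N_localized _ _ Np px_gt0.
have /(congr1 sval)/= Lp : exist _ _ NL = exist _ _ Np :> T.
  by apply: pmin; apply/asboolP => z /=; exact: localized_le.
by rewrite -{1 3}Lp localized_mul.
Qed.

End MultiplicativeSeminorm.

(** * Characters from multiplicative seminorms *)

Section GelfandMazur.
Variables (R : realType) (A : cstarAlgType R) (abelA : abelian_alg A).
Variables (p : A -> R) (a : A).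
Hypotheses (p_seminorm : square_seminorm p) (pa1 : p a = 1).
Hypothesis pM : forall x y, p (x ** y) = p x * p y.
Implicit Types (x y z : A) (l m s : R[i]).

Let p_bound x : 0 <= p x <= nrm x. Proof. by case: p_seminorm. Qed.
Let p_ge0 x : 0 <= p x. Proof. by case/andP: (p_bound x). Qed.
Let pD x y : p (x + y) <= p x + p y. Proof. by case: p_seminorm. Qed.
Let pZ l x : p (l *: x) = nrm l * p x. Proof. by case: p_seminorm. Qed.

(** The value of the seminorm at [l + x] in the algebra with a unit adjoined;
    since [p a = 1], it is the value of [p] at [(l + x) a]. *)
Let p1 l x := p (l *: a + x ** a).

Let p1_ge0 l x : 0 <= p1 l x. Proof. exact: p_ge0. Qed.

Let p1_0 x : p1 0 x = p x.
Proof. by rewrite /p1 scale0r add0r pM pa1 mulr1. Qed.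

Let p1_lipschitz l m x : p1 l x <= p1 m x + nrm (l - m).
Proof.
have -> : nrm (l - m) = p ((l - m) *: a) by rewrite pZ pa1 mulr1.
apply: le_trans (pD _ _); rewrite le_eqVlt; apply/orP; left; apply/eqP.
by rewrite /p1 scalerBl addrAC [m *: a + _]addrC subrK.
Qed.

Let nrm_le_p1 l x : nrm l <= p1 l x + p x.
Proof.
have -> : nrm l = p (l *: a) by rewrite pZ pa1 mulr1.
rewrite -{1}(addrK (x ** a) (l *: a)); apply: le_trans (pD _ _) _.
by rewrite lerD2l -scaleN1r pZ nrmN nrmC1 mul1r pM pa1 mulr1.
Qed.

Let p1_sqr l s x :
  p1 (l - s) x * p1 (l + s) x = p1 (l ^+ 2 - s ^+ 2) ((l *+ 2) *: x + x ** x).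
Proof.
rewrite -[RHS]mulr1 -pa1 /p1 -!pM; congr p.
rewrite !(cmulDl, cmulDr, cscalerAl, cscalerAr, scalerDr, scalerA) !addrA.
have -> : x ** a ** (x ** a) = x ** x ** a ** a.
  by rewrite !cmulA -(cmulA x a x) (abelA a x) cmulA.
have -> : a ** (x ** a) = x ** a ** a by rewrite (abelA a).
congr (_ + _); rewrite (_ : l ^+ 2 - s ^+ 2 = (l - s) * (l + s)); last by ring.
rewrite -!addrA; congr (_ + _); rewrite -scalerDl; congr (_ *: _); ring.
Qed.

(** Ostrowski's argument: with [t = l + x] and [n = 2 ^ k], the element
    [t ^ n - s ^ n] is the product of [t - s] and [n - 1] other elements of
    the form [t - s'], whose seminorm is at least [m].  So
    [p1 (t - s) m ^ (n - 1) <= p1 t ^ n + |s| ^ n = m ^ n + |s| ^ n], that is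
    [p1 (t - s) <= m (1 + (|s| / m) ^ n)], which tends to [m] if [|s| < m]. *)
Let p1_flat (m : R) l x s : 0 < m -> p1 l x = m ->
  (forall s', m <= p1 (l - s') x) -> nrm s = m / 2 -> p1 (l - s) x = m.
Proof.
move=> m0 p1lx pmin ns; apply/le_anti; rewrite pmin andbT.
pose sq (t : R[i] * A) := (t.1 ^+ 2, (t.1 *+ 2) *: t.2 + t.2 ** t.2).
pose t k := iter k sq (l, x).
have low k s' : m ^+ (2 ^ k) <= p1 ((t k).1 - s') (t k).2.
  elim: k s' => [|k IH] s' /=; first by rewrite expr1 pmin.
  rewrite -[s']sqr_sqrtc -p1_sqr expnS mul2n -addnn exprD.
  have := IH (- sqrtc s'); rewrite opprK => IH'.
  by rewrite ler_pM ?exprn_ge0 // ltW.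
have top k : p1 (t k).1 (t k).2 = m ^+ (2 ^ k).
  elim: k => [|k IH] /=; first by rewrite expr1.
  have := p1_sqr (t k).1 0 (t k).2.
  rewrite expr0n /= !subr0 addr0 => <-.
  by rewrite IH -exprD addnn -mul2n -expnS.
have prod k : p1 (l - s) x * m ^+ (2 ^ k) <=
    m * p1 ((t k).1 - s ^+ (2 ^ k)) (t k).2.
  elim: k => [|k IH] /=; first by rewrite !expr1 mulrC.
  have -> : s ^+ (2 ^ k.+1) = (s ^+ (2 ^ k)) ^+ 2 by rewrite -exprM -expnSr.
  rewrite -p1_sqr expnS mul2n -addnn exprD mulrA.
  rewrite [leRHS]mulrA; apply: ler_pM IH _ => //.
  - by rewrite mulr_ge0 ?exprn_ge0 // ltW.
  - by rewrite exprn_ge0 // ltW.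
  - by have := low k (- s ^+ (2 ^ k)); rewrite opprK.
have bound k : p1 (l - s) x <= m + m * 2^-1 ^+ (2 ^ k).
  have mk : 0 < m ^+ (2 ^ k) by rewrite exprn_gt0.
  rewrite -(ler_pM2r mk); apply: le_trans (prod k) _.
  apply: le_trans (ler_wpM2l (ltW m0) (p1_lipschitz _ (t k).1 _)) _.
  rewrite top addrAC subrr add0r nrmN nrmCX ns.
  by rewrite expr_div_n exprVn le_eqVlt; apply/orP; left; apply/eqP; ring.
apply/ler_addgt0Pl => e e0.
have /cvgrPdist_lt/(_ (e / m)) : (2^-1 : R) ^+ n @[n --> \oo] --> (0 : R).
  by apply: cvg_expr; rewrite ger0_norm ?invf_lt1 ?ltr1n.
rewrite divr_gt0 // => /(_ isT)[N _ /(_ N (leqnn N))] /=.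
rewrite sub0r normrN ger0_norm ?exprn_ge0 ?invr_ge0 // ltr_pdivlMr // => He.
have He' : m * 2^-1 ^+ (2 ^ N) <= m * 2^-1 ^+ N.
  rewrite ler_pM2l //; apply: ler_wiXn2l; rewrite ?invr_ge0 ?invf_le1 ?ler1n //.
  exact/ltnW/ltn_expl.
by move: (bound N) He He'; move: (p1 _ _) (_ ^+ N) (_ ^+ (2 ^ N)) => ? ? ?; lra.
Qed.

(** The theorem of Gelfand and Mazur: were the minimum [m] of [p1 (x - l)]
    positive, it would also be attained at [l + m / 2] for each minimizer [l],
    hence at arbitrarily large [l]; but [p1 (x - l)] grows like [|l|]. *)
Lemma ex_eigenvalue x : exists l, p (x ** a - l *: a) = 0.
Proof.
pose f (l : R[i]^o) := p1 (- l) x.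
have fL l m : f l - f m <= 1 * nrm (l - m).
  have -> : nrm (l - m) = nrm (- l - - m) by rewrite -nrmN opprB opprK addrC.
  by rewrite mul1r lerBlDl; exact: p1_lipschitz.
have f_cont := @lipschitz_continuous R R[i]^o f 1 fL.
pose M := p x + p x + 1.
have M0 : 0 <= M by rewrite !addr_ge0.
have [||l0 _ lmin] := @compact_EVT_min R[i]^o R f _ _ (@compact_square R M).
- by exists 0; rewrite /= !normr0.
- exact: continuous_subspaceT.
have {}lmin l : f l0 <= f l.
  have f0 : f 0 = p x by rewrite /f oppr0 p1_0.
  have [lM|lM] := pselect (`|complex.Re l| <= M /\ `|complex.Im l| <= M).
    by apply: lmin; rewrite inE.
  have lM' : M < nrm l.
    rewrite ltNge; apply/negP => nM; apply: lM.
    by split; apply: le_trans nM; rewrite ?nrmC_Re ?nrmC_Im.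
  have l0p : f l0 <= p x.
    by rewrite -f0; apply: lmin; rewrite inE /= normr0.
  have := nrm_le_p1 (- l) x; rewrite nrmN -/(f l) => lf.
  by rewrite /M in lM'; lra.
have [fl0|m0] := ge0_eqVlt (p1_ge0 (- l0) x).
  exists l0; rewrite -scaleNr addrC; exact: fl0.
exfalso; pose m := f l0; rewrite -/(f l0) -/m in m0.
pose h := (m / 2)%:C.
have nh : nrm h = m / 2 by rewrite nrmCR ger0_norm // divr_ge0 // ltW.
have flat n : f (l0 + h *+ n) = m.
  elim: n => [|n IH]; first by rewrite mulr0n addr0.
  rewrite /f mulrS (addrC h) addrA opprD; apply: p1_flat nh => //.
  by move=> s; rewrite -opprD; exact: lmin.
have [n nP] : exists n : nat, (nrm l0 + m + p x) / (m / 2) < n%:R.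
  exists (Num.trunc ((nrm l0 + m + p x) / (m / 2))).+1.
  by rewrite truncnS_gt.
rewrite ltr_pdivrMr ?divr_gt0 // in nP.
have := nrm_le_p1 (- (l0 + h *+ n)) x; rewrite -/(f _) flat nrmN => le1.
have le2 : nrm (h *+ n) <= nrm (l0 + h *+ n) + nrm l0.
  by rewrite -{1}(addKr l0 (h *+ n)) addrC -[X in _ <= _ + X]nrmN nrmD.
have : nrm (h *+ n) = n%:R * (m / 2).
  rewrite -[h *+ n]mulr_natl nrmCM nh -(rmorph_nat (real_complex R)).
  by rewrite nrmCR normr_nat.
by lra.
Qed.

End GelfandMazur.

(** For a multiplicative seminorm [p] that is exact at [a], mapping [x] to its
    eigenvalue modulo the kernel of [p] defines a character with the required
    value at [a]. *)
Lemma ex_norming_character (R : realType) (A : cstarAlgType R) (a : A) :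
  abelian_alg A -> a != 0 ->
  exists2 phi, characters phi & nrm (phi a : R[i]) = nrm a.
Proof.
move=> abelA a0; have [b bE] : exists b, b = (nrm a)%:C^-1 *: a by eexists.
have na : 0 < nrm a by rewrite nrm_gt0.
have nb : nrm b = 1.
  by rewrite bE nrmZ nrmCV nrmCR gtr0_norm // mulVf // gt_eqF.
have [p [pP pb pM]] := ex_multiplicative_seminorm abelA nb.
have [phi phiP] := choice (ex_eigenvalue abelA pP pb pM).
have [p_bound pD pZ _ _] := pP.
have p_ge0 x : 0 <= p x by case/andP: (p_bound x).
have p_null x y : p x = 0 -> p y = 0 -> p (x + y) = 0.
  move=> px py; apply/le_anti; rewrite p_ge0 andbT.
  by apply: le_trans (pD _ _) _; rewrite px py addr0.
have phi_uniq x l : p (x ** b - l *: b) = 0 -> phi x = l.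
  move=> pl; have pN : p (- (x ** b - l *: b)) = 0.
    by rewrite -scaleN1r pZ pl mulr0.
  have := p_null _ _ (phiP x) pN.
  rewrite opprB addrC addrA subrK -scalerBl pZ pb mulr1 => /eqP.
  by rewrite nrm_eq0 subr_eq0 => /eqP.
have phi_scalar l x y : phi (l *: x + y) = l * phi x + phi y.
  apply: phi_uniq.
  have -> : (l *: x + y) ** b - (l * phi x + phi y) *: b =
     l *: (x ** b - phi x *: b) + (y ** b - phi y *: b).
    by rewrite cmulDl cscalerAl scalerBr scalerDl scalerA opprD addrACA.
  by apply: p_null => //; rewrite pZ phiP mulr0.
have phiM x y : phi (x ** y) = phi x * phi y.
  apply: phi_uniq.
  have -> : x ** y ** b - (phi x * phi y) *: b =
     x ** (y ** b - phi y *: b) + phi y *: (x ** b - phi x *: b).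
    rewrite cmulBr cmulA cscalerAr scalerBr scalerA addrA subrK.
    by rewrite (mulrC (phi y)).
  by apply: p_null; rewrite ?pM ?pZ phiP mulr0.
have phiZ l x : phi (l *: x) = l * phi x.
  have phi0 : phi 0 = 0.
    by apply: phi_uniq; rewrite cmul0r scale0r subr0 -(scale0r b) pZ nrm0 mul0r.
  by have := phi_scalar l x 0; rewrite !addr0 phi0 addr0.
have phi_b : nrm (phi b) = 1.
  have : p (phi b *: b) <= 1 /\ 1 <= p (phi b *: b).
    have pbb : p (b ** b) = 1 by rewrite pM pb mulr1.
    have e1 : p (phi b *: b - b ** b) = 0.
      by rewrite -opprB -scaleN1r pZ phiP mulr0.
    split.
      rewrite -(subrK (b ** b) (phi b *: b)).
      by apply: le_trans (pD _ _) _; rewrite e1 add0r pbb.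
    rewrite -{1}pbb -(subrK (phi b *: b) (b ** b)).
    by apply: le_trans (pD _ _) _; rewrite phiP add0r.
  by rewrite pZ pb mulr1 => -[? ?]; apply/le_anti/andP.
have phi_a : phi a = (nrm a)%:C * phi b.
  rewrite bE phiZ mulrA mulfV ?mul1r //.
  by rewrite -[0]/(0%:C) (inj_eq (@complexI _)) gt_eqF.
exists phi; last by rewrite phi_a nrmCM phi_b mulr1 nrmCR gtr0_norm.
split=> //; exists b; rewrite -nrm_eq0 phi_b; exact: oner_neq0.
Qed.

(** * Continuity and reality of characters *)

Lemma nrm_complete (R : realType) (V : completeNormedModType R[i])
    (u : nat -> V) :
  (forall e : R, 0 < e -> exists N, forall m n, (N <= m)%N -> (N <= n)%N ->
     nrm (u m - u n) < e) ->
  exists l, forall e : R, 0 < e -> exists N, forall n, (N <= n)%N ->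
     nrm (l - u n) < e.
Proof.
move=> u_cauchy.
have /cauchy_cvg/cvg_ex[l /cvg_nrmP ul] : cauchy (u @ \oo).
  apply/cauchy_ballP => e e0.
  have ee : e = (complex.Re e)%:C.
    by move: e0; rewrite ltcE => /andP[/eqP]; case: (e) => a b /= ->.
  have [|N uN] := u_cauchy (complex.Re e); first by rewrite -ltcR -ee.
  pose U := u @` [set n | (N <= n)%N].
  have FU : (u @ \oo) U by exists N => // n Nn; exists n.
  exists (U, U) => // -[_ _] [[m Nm <-] [n Nn <-]].
  by rewrite -ball_normE /= normE ee ltcR; exact: uN.
by exists l => e /ul[N _ lN]; exists N.
Qed.

Section TransposedEigenvector.
Variables (R : realType) (V : completeNormedModType R[i]).
Variables (phi : V -> R[i]) (T : V -> V) (C : R) (c : R[i]) (b : V).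
Hypotheses (phi_scalar : scalar phi) (phib : phi b != 0).
Hypotheses (TB : forall x y, T (x - y) = T x - T y).
Hypotheses (T_bound : forall x, nrm (T x) <= C * nrm x).
Hypotheses (phiT : forall x, phi (T x) = c * phi x).

(** If [C < |c|], put [S = T / c]: the Neumann series
    [y = b + S b + S^2 b + ...] converges and satisfies [y = b + S y], so that
    [phi y = phi b + phi y], against [phi b <> 0].  For a character and the
    multiplication by an element this gives continuity. *)
Lemma eigenvalue_le_bound : nrm c <= C.
Proof.
rewrite leNgt; apply/negP => Cc.
have b0 : 0 < nrm b.
  rewrite nrm_gt0; apply: contraNneq phib => ->.
  by have := phi_scalar (-1) 0 0; rewrite scaler0 addr0 mulN1r addNr => ->.
have C0 : 0 <= C.
  by rewrite -(pmulr_lge0 _ b0); apply: le_trans (T_bound b); rewrite nrm_ge0.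
have c0 : 0 < nrm c := le_lt_trans C0 Cc.
have cn0 : c != 0 by rewrite -nrm_gt0.
pose r := C / nrm c.
have r0 : 0 <= r by rewrite divr_ge0 // ltW.
have r1 : r < 1 by rewrite ltr_pdivrMr // mul1r.
pose S x := c^-1 *: T x.
have SB x y : S (x - y) = S x - S y by rewrite /S TB scalerBr.
have S_bound x : nrm (S x) <= r * nrm x.
  by rewrite nrmZ nrmCV mulrC ler_pdivrMr // mulrAC divfK ?gt_eqF.
have phiS x : phi (S x) = phi x.
  have := phi_scalar c^-1 (T x) 0; rewrite addr0 => ->.
  have phi0 : phi 0 = 0.
    by have := phi_scalar (-1) 0 0; rewrite scaler0 addr0 mulN1r addNr => ->.
  by rewrite phi0 addr0 phiT mulrA mulVf // mul1r.
pose y n := iter n (fun x => b + S x) 0.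
pose B := nrm b / (1 - r).
have r1' : 0 < 1 - r by rewrite subr_gt0.
have yB n : nrm (y n) <= B.
  elim: n => [|n IH] /=; first by rewrite nrm0 divr_ge0 ?nrm_ge0 // ltW.
  apply: le_trans (nrmD _ _) _.
  have -> : B = nrm b + r * B.
    by rewrite /B; field; rewrite gt_eqF.
  by rewrite lerD2l; apply: le_trans (S_bound _) _; rewrite ler_wpM2l.
have y_diff n k : nrm (y (n + k)%N - y n) <= r ^+ n * B.
  elim: n => [|n IH]; first by rewrite expr0 mul1r add0n subr0.
  rewrite addSn /= opprD addrACA subrr add0r -SB.
  by apply: le_trans (S_bound _) _; rewrite exprS -mulrA ler_wpM2l.
have B0 : 0 < B by rewrite divr_gt0.
have small e : 0 < e -> exists N, r ^+ N * B < e.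
  move=> e0; have /cvgrPdist_lt/(_ (e / B)) : r ^+ n @[n --> \oo] --> (0 : R).
    by apply: cvg_expr; rewrite ger0_norm.
  rewrite divr_gt0 // => /(_ isT)[N _ /(_ N (leqnn N))] /=.
  by rewrite sub0r normrN ger0_norm ?exprn_ge0 // ltr_pdivlMr // => H; exists N.
have [l yl] : exists l, forall e : R, 0 < e -> exists N, forall n, (N <= n)%N ->
     nrm (l - y n) < e.
  apply: nrm_complete => e e0.
  have [|N Ne] := small (e / 2); first by rewrite divr_gt0.
  exists N => m n Nm Nn; rewrite (splitr e).
  apply: le_lt_trans (nrm_triangle (y N) _ _) _; apply: ltrD.
    by rewrite -(subnKC Nm); apply: le_lt_trans (y_diff _ _) Ne.
  by rewrite nrm_distC -(subnKC Nn); apply: le_lt_trans (y_diff _ _) Ne.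
have lE : l = b + S l.
  apply/eqP; rewrite -subr_eq0 -nrm_eq0 eq_le nrm_ge0 andbT.
  apply/ler_addgt0Pl => e e0; rewrite addr0.
  have [|N lN] := yl (e / 2); first by rewrite divr_gt0.
  apply: le_trans (nrm_triangle (y N.+1) _ _) _; rewrite (splitr e).
  apply: lerD; first exact/ltW/lN.
  rewrite /= opprD addrACA subrr add0r -SB.
  apply: le_trans (S_bound _) _; rewrite -[leRHS]mul1r nrm_distC.
  by rewrite ler_pM ?nrm_ge0 // ltW // lN.
have /eqP := congr1 phi lE.
have := phi_scalar 1 b (S l); rewrite scale1r mul1r => ->.
by rewrite phiS -subr_eq0 opprD addrCA subrr addr0 oppr_eq0 (negbTE phib).
Qed.

End TransposedEigenvector.

Section Characters.
Variables (R : realType) (A : cstarAlgType R) (phi : A -> R[i]).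
Hypotheses (phi_scalar : scalar phi).
Hypothesis phiM : forall a b, phi (a ** b) = phi a * phi b.

Lemma char0 : phi 0 = 0.
Proof. by have := phi_scalar (-1) 0 0; rewrite scaler0 addr0 mulN1r addNr. Qed.

Lemma charZ l a : phi (l *: a) = l * phi a.
Proof. by have := phi_scalar l a 0; rewrite addr0 char0 addr0. Qed.

Lemma charD a b : phi (a + b) = phi a + phi b.
Proof. by have := phi_scalar 1 a b; rewrite scale1r mul1r. Qed.

Lemma charN a : phi (- a) = - phi a.
Proof. by rewrite -scaleN1r charZ mulN1r. Qed.

Lemma charB a b : phi (a - b) = phi a - phi b.
Proof. by rewrite charD charN. Qed.

Lemma char_bound a : nrm (phi a) <= nrm a.
Proof.
have [[b phib]|phi0] := pselect (exists b, phi b != 0); last first.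
  have -> : phi a = 0 by apply: contrapT => /eqP pa; apply: phi0; exists a.
  by rewrite nrm0 nrm_ge0.
apply: (@eigenvalue_le_bound R A phi (cmul a) (nrm a) (phi a) b) => //.
- by move=> x y; rewrite cmulBr.
- by move=> x; exact: nrmM.
Qed.

(** For real [t], the operator [x |-> (a + i t) x] satisfies
    [|(a + i t) x|^2 = |x^* (a^2 + t^2) x| <= (|a|^2 + t^2) |x|^2], whence
    [(Im (phi a) + t)^2 <= |a|^2 + t^2] for all [t]. *)
Lemma char_real a : self_adjoint a -> complex.Im (phi a) = 0.
Proof.
move=> asa.
have [[b phib]|phi0] := pselect (exists b, phi b != 0); last first.
  by have -> : phi a = 0 by apply: contrapT => /eqP pa; apply: phi0; exists a.
have key (t : R) : (complex.Im (phi a) + t) ^+ 2 <= nrm a ^+ 2 + t ^+ 2.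
  pose it : R[i] := (0 +i* t)%C; pose D := nrm a ^+ 2 + t ^+ 2.
  have D0 : 0 <= D by rewrite addr_ge0 ?sqr_ge0.
  pose T x := a ** x + it *: x.
  have : nrm (phi a + it) <= Num.sqrt D.
    apply: (@eigenvalue_le_bound R A phi T _ _ b) => //.
    - by move=> x y; rewrite /T cmulBr scalerBr opprD addrACA.
    - move=> x.
      rewrite -(@ler_pXn2r _ 2) ?nnegrE ?nrm_ge0 ?mulr_ge0 ?nrm_ge0 //.
      rewrite exprMn sqr_sqrtr // -nrm_starM.
      have -> : cstar (T x) ** T x =
          cstar x ** (a ** a ** x) + (t ^+ 2)%:C *: (cstar x ** x).
        rewrite /T cstarD cstarZ cstarM asa.
        have -> : (it^*)%R = - it.
          by apply/eqP; rewrite eq_complex /= oppr0 !eqxx.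
        rewrite !(cmulDl, cmulDr, cscalerAl, cscalerAr) !cmulA.
        rewrite !scaleNr addrA addrK scalerA -scaleNr; congr (_ + _ *: _).
        apply/eqP; rewrite /it eq_complex /=.
        by apply/andP; split; apply/eqP; ring.
      rewrite /D mulrDl; apply: le_trans (nrmD _ _) _.
      rewrite nrmZ nrmCR ger0_norm ?sqr_ge0 // nrm_starM lerD2r.
      apply: le_trans (nrmM _ _) _; rewrite nrm_star.
      have := ler_wpM2l (nrm_ge0 x) (nrmM (a ** a) x).
      move=> /le_trans; apply.
      have -> : nrm a ^+ 2 * nrm x ^+ 2 = nrm x * (nrm a * nrm a * nrm x).
        by ring.
      by rewrite ler_wpM2l ?nrm_ge0 // ler_wpM2r ?nrm_ge0 // nrmM.
    - by move=> x; rewrite /T charD phiM charZ mulrDl.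
  rewrite -(@ler_pXn2r _ 2) ?nnegrE ?nrm_ge0 ?sqrtr_ge0 // sqr_sqrtr //.
  rewrite nrmC_sqr; apply: le_trans.
  by case: (phi a) => u v /=; rewrite lerDr sqr_ge0.
apply/eqP/negPn/negP => Im0.
move: (complex.Im (phi a)) (nrm a ^+ 2) Im0 key => u N u0 key.
have := key (N / (2 * u)).
have -> : (u + N / (2 * u)) ^+ 2 = u ^+ 2 + N + (N / (2 * u)) ^+ 2 by field.
rewrite lerD2r gerDr leNgt => /negP; apply.
by rewrite lt_def sqrf_eq0 u0 sqr_ge0.
Qed.

Lemma char_selfadjoint a : self_adjoint a -> phi a = (complex.Re (phi a))%:C.
Proof. by move=> /char_real; case: (phi a) => u v /= ->. Qed.

End Characters.

Lemma characters0P (R : realType) (A : cstarAlgType R) (phi : A -> R[i]) :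
  scalar phi -> (forall a b, phi (a ** b) = phi a * phi b) ->
  characters phi \/ phi = fun=> 0.
Proof.
move=> ps pM; have [pa|nc] := pselect (exists a, phi a != 0); first by left.
right; apply/funext => a; apply/eqP/negPn/negP => pa.
by apply: nc; exists a.
Qed.

(** * The Stone-Weierstrass theorem *)

Lemma compact_finite_subcover (K : topologicalType) (U : K -> set K) :
  compact [set: K] -> (forall x, nbhs x (U x)) ->
  exists s : seq K, forall y, exists2 x, x \in s & U x y.
Proof.
move=> /compact_near_coveringP cK Ux.
pose F := filter_from [set: seq K]
  (fun s0 => [set s : seq K | {subset s0 <= s}]).
have FF : Filter F.
  apply: filter_from_filter; first by exists [::].
  move=> s t _ _; exists (s ++ t) => // v stv.
  by split=> x xs; apply: stv; rewrite mem_cat xs ?orbT.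
have [|s _ sP] := cK _ F (fun s y => exists2 x, x \in s & U x y) FF.
  move=> x _; exists (U x, [set s : seq K | {subset [:: x] <= s}]) => /=.
    by split=> //; exists [:: x].
  by move=> [y s] /= [Uy xs]; exists x => //; apply: xs; rewrite mem_head.
by exists s => y; exact: (sP s).
Qed.

Section StoneWeierstrass.
Variables (R : realType) (K : topologicalType) (L : set (K -> R)).
Hypothesis cK : compact [set: K].
Hypothesis L_continuous : forall f, L f -> continuous f.
Hypothesis L0 : L (fun=> 0).
Hypothesis LD : forall f g, L f -> L g -> L (fun x => f x + g x).
Hypothesis LM : forall f g, L f -> L g -> L (fun x => f x * g x).
Hypothesis LZ : forall c f, L f -> L (fun x => c * f x).

Definition uniform_closure : set (K -> R) :=
  [set f | forall e, 0 < e -> exists2 g, L g & forall x, `|f x - g x| <= e].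

Let ucl := uniform_closure.

Let L_ucl f : L f -> ucl f.
Proof. by move=> Lf e e0; exists f => // x; rewrite subrr normr0 ltW. Qed.

Let uclD f g : ucl f -> ucl g -> ucl (fun x => f x + g x).
Proof.
move=> uf ug e e0; have e2 : 0 < e / 2 by rewrite divr_gt0.
have [f' Lf' ff'] := uf _ e2; have [g' Lg' gg'] := ug _ e2.
exists (fun x => f' x + g' x); first exact: LD.
move=> x; rewrite opprD addrACA (splitr e).
by apply: le_trans (ler_normD _ _) _; rewrite lerD.
Qed.

Let uclZ c f : ucl f -> ucl (fun x => c * f x).
Proof.
move=> uf e e0; have c0 : 0 < `|c| + 1 by rewrite ltr_wpDl.
have [|g Lg fg] := uf (e / (`|c| + 1)); first by rewrite divr_gt0.
exists (fun x => c * g x); first exact: LZ.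
move=> x; rewrite -mulrBr normrM.
apply: le_trans (ler_wpM2l (normr_ge0 _) (fg x)) _.
by rewrite mulrA ler_pdivrMr // mulrC ler_wpM2l ?(ltW e0) // lerDl.
Qed.

(** The iteration [p' = p + (t^2 - p^2) / 2] increases from [0] to [|t|] on
    [-1 <= t <= 1], at a rate independent of [t]; its terms are polynomials in
    [t] without constant term. *)
Let abs_iter (t : R) n := iter n (fun p : R => p + 2^-1 * (t * t - p * p)) 0.

Let abs_iter_bound t n : `|t| <= 1 ->
  [/\ 0 <= abs_iter t n, abs_iter t n <= `|t| &
      (`|t| - abs_iter t n) * (1 + n%:R * (`|t| / 2)) <= `|t|].
Proof.
move=> t1; elim: n => [|n [p0 pt IH]] /=.
  by rewrite subr0 mul0r addr0 mulr1.
move: (abs_iter t n) p0 pt IH => p p0 pt IH.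
have -> : t * t = `|t| * `|t| by rewrite -normrM ger0_norm // -expr2 sqr_ge0.
move: `|t| (normr_ge0 t) t1 p0 pt IH => u u0 u1 p0 pu IH.
have d0 : 0 <= u - p by rewrite subr_ge0.
have e : u - (p + 2^-1 * (u * u - p * p)) = (u - p) * (1 - (u + p) / 2).
  by field.
split.
- by rewrite addr_ge0 // mulr_ge0 ?invr_ge0 // subr_ge0 ler_pM.
- by rewrite -subr_ge0 e mulr_ge0 //; lra.
rewrite e; apply: le_trans IH; rewrite -mulrA; apply: ler_wpM2l => //.
rewrite -(natr1 n).
have n0 : 0 <= n%:R :> R by [].
move: (n%:R : R) n0 => m m0.
have mu0 : 0 <= m * (u / 2) by rewrite mulr_ge0 // divr_ge0.
have h1 : (1 - (u + p) / 2) * (1 + (m + 1) * (u / 2))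
    <= (1 - u / 2) * (1 + (m + 1) * (u / 2)).
  by apply: ler_wpM2r; lra.
apply: le_trans h1 _.
have : 0 <= u / 2 * (m * (u / 2)) by rewrite mulr_ge0 // divr_ge0.
have : 0 <= (u / 2) * (u / 2) by rewrite mulr_ge0 // divr_ge0.
by lra.
Qed.

Let abs_iter_approx t n : `|t| <= 1 ->
  `| `|t| - abs_iter t n.+1| <= 2 / n.+1%:R.
Proof.
move=> t1; have [p0 pt bound] := abs_iter_bound n.+1 t1.
rewrite ger0_norm ?subr_ge0 //.
have [t0|t0] := ge0_eqVlt (normr_ge0 t).
  by rewrite lerBlDr t0 addr_ge0 // divr_ge0.
rewrite ler_pdivlMr ?ltr0n //.
move: (abs_iter t n.+1) (n.+1%:R : R) (`|t|) p0 pt bound t0 => p m u p0 pu h u0.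
rewrite -(ler_pM2r u0).
have : 0 <= u - p by rewrite subr_ge0.
by lra.
Qed.

Let L_bounded f : L f -> exists2 M : R, 0 < M & forall x, `|f x| <= M.
Proof.
move=> /L_continuous cf.
have /ex_strict_bound_gt0[M M0 fM] : bounded_set (f @` [set: K]).
  apply/compact_bounded/continuous_compact => //.
  exact: continuous_subspaceT.
by exists M => // x; apply/ltW/fM; exists x.
Qed.

Let ucl_abs f : ucl f -> ucl (fun x => `|f x|).
Proof.
move=> uf e e0; have e2 : 0 < e / 2 by rewrite divr_gt0.
have [g Lg fg] := uf _ e2; have [M M0 gM] := L_bounded Lg.
have [n nP] : exists n : nat, M * 2 / n.+1%:R <= e / 2.
  exists (Num.trunc (M * 2 / (e / 2))).
  rewrite ler_pdivrMr ?ltr0n // (mulrC (e / 2)) -ler_pdivrMr //.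
  by rewrite ltW // truncnS_gt.
exists (fun x => M * abs_iter (M^-1 * g x) n.+1).
  apply: LZ; elim: n.+1 => [|k IH] //=.
  have LN h h' : L h -> L h' -> L (fun x => h x - h' x).
    move=> Lh Lh'; have := LD Lh (LZ (-1) Lh').
    by congr L; apply/funext => x; rewrite mulN1r.
  by apply: LD => //; apply: (LZ 2^-1); apply: LN; apply: LM => //; exact: LZ.
move=> x; have gx1 : `|M^-1 * g x| <= 1.
  by rewrite normrM normfV (gtr0_norm M0) ler_pdivrMl // mulr1.
have := abs_iter_approx n gx1; rewrite normrM normfV (gtr0_norm M0) => h.
have h' : `| `|g x| - M * abs_iter (M^-1 * g x) n.+1| <= e / 2.
  have -> : `|g x| - M * abs_iter (M^-1 * g x) n.+1 =
      M * (M^-1 * `|g x| - abs_iter (M^-1 * g x) n.+1).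
    by rewrite mulrBr mulVKf // gt_eqF.
  apply: le_trans nP; rewrite normrM (gtr0_norm M0) -mulrA.
  by rewrite ler_wpM2l // ltW.
rewrite (splitr e) -(subrK `|g x| `|f x|) -addrA.
apply: le_trans (ler_normD _ _) _; apply: lerD h'.
exact: le_trans (ler_dist_dist _ _) (fg x).
Qed.

Let ucl_max f g : ucl f -> ucl g -> ucl (fun x => Num.max (f x) (g x)).
Proof.
move=> uf ug.
have := uclZ 2^-1 (uclD (uclD uf ug) (ucl_abs (uclD uf (uclZ (-1) ug)))).
by congr ucl; apply/funext => x; rewrite mulN1r maxr_absE mulrC.
Qed.

Let ucl_min f g : ucl f -> ucl g -> ucl (fun x => Num.min (f x) (g x)).
Proof.
move=> uf ug.
have := uclZ 2^-1 (uclD (uclD uf ug)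
  (uclZ (-1) (ucl_abs (uclD uf (uclZ (-1) ug))))).
by congr ucl; apply/funext => x; rewrite !mulN1r minr_absE mulrC.
Qed.

(** Finitely many interpolants through [(x, f x)], one for each open set of a
    cover, have a maximum that is nowhere much below [f]; then finitely many
    such maxima, for varying [x], have a minimum that is close to [f]. *)
Theorem stone_weierstrass f : continuous f ->
  (forall x y, exists g, [/\ L g, g x = f x & g y = f y]) ->
  uniform_closure f.
Proof.
move=> cf interp e0 e0_gt0; pose e := e0 / 2.
have e_gt0 : 0 < e by rewrite divr_gt0.
pose C (g : K -> R) := ucl g /\ continuous g.
have C_max g h : C g -> C h -> C (fun x => Num.max (g x) (h x)).
  move=> [ug cg] [uh ch]; split; first exact: ucl_max.
  by move=> x; apply: continuous_max; [exact: cg|exact: ch].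
have C_min g h : C g -> C h -> C (fun x => Num.min (g x) (h x)).
  move=> [ug cg] [uh ch]; split; first exact: ucl_min.
  by move=> x; apply: continuous_min; [exact: cg|exact: ch].
have open_gap (g h : K -> R) x : continuous g -> continuous h ->
    g x < h x + e -> nbhs x [set z | g z < h z + e].
  move=> cg ch gh.
  have /(_ x) cgh : continuous (fun z => g z - h z).
    by move=> z; apply: cvgB; [exact: cg|exact: ch].
  have : nbhs (g x - h x) [set r | r < e].
    by apply: lt_nbhsl; rewrite ltrBlDl.
  move=> /cgh near_e; apply: (@filterS _ (nbhs x) _ _ _ _ near_e) => z /=.
  by rewrite ltrBlDl.
have above x : exists g, [/\ C g, g x = f x & forall z, f z < g z + e].
  have [g gP] := choice (fun y => interp x y).
  have gC y : C (g y).
    by have [Lg _ _] := gP y; split; [exact: L_ucl|exact: L_continuous].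
  have [|s sP] := @compact_finite_subcover K
      (fun y => [set z | f z < g y z + e]) cK.
    move=> y; apply: (open_gap f (g y)) => //; first by case: (gC y).
    by case: (gP y) => _ _ ->; rewrite ltrDl.
  have [h [Ch hx hs]] : exists h, [/\ C h, h x = f x &
      forall y z, y \in s -> g y z <= h z].
    elim: s {sP} => [|y s [h [Ch hx hs]]].
      by exists (g x); case: (gP x).
    exists (fun z => Num.max (g y z) (h z)); split; first exact: C_max.
      by have [_ -> _] := gP y; rewrite hx maxxx.
    move=> y' z; rewrite inE le_max => /orP[/eqP ->|/hs ->].
      by rewrite lexx.
    by rewrite orbT.
  exists h; split=> // z; have [y ys fz] := sP z.
  by apply: lt_le_trans fz _; rewrite lerD2r hs.
have [g gP] := choice above.
have gC x : C (g x) by case: (gP x).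
have [|s sP] := @compact_finite_subcover K
    (fun y => [set z | g y z < f z + e]) cK.
  move=> y; apply: (open_gap (g y) f) => //; first by case: (gC y).
  by case: (gP y) => _ -> _; rewrite ltrDl.
have [[x0 _]|K0] := pselect (exists x : K, True); last first.
  by exists (fun=> 0) => // x; case: K0; exists x.
have [h [[uh _] hf hs]] : exists h, [/\ C h, forall z, f z < h z + e &
    forall y z, y \in s -> h z <= g y z].
  elim: s {sP} => [|y s [h [Ch hf hs]]].
    by exists (g x0); case: (gP x0).
  exists (fun z => Num.min (g y z) (h z)); split; first exact: C_min.
    by move=> z; case: (gP y) => _ _ gy; rewrite /Num.min; case: ifP.
  move=> y' z; rewrite inE ge_min => /orP[/eqP ->|/hs ->].
    by rewrite lexx.
  by rewrite orbT.
have [h' Lh' hh'] := uh _ e_gt0.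
exists h' => // x; rewrite (splitr e0) -/e -(subrK (h x) (f x)) -addrA.
apply: le_trans (ler_normD _ _) _; apply: lerD (hh' x).
have [y ys gy] := sP x; have := hs y x ys; have := hf x; move: gy => /=.
by rewrite ler_norml; lra.
Qed.

End StoneWeierstrass.

(** * The compact space of characters and zero *)

Section SetTypeTopology.
Variables (T : topologicalType) (S : set T).

Lemma nbhs_set_typeP (x : set_type S) (U : set (set_type S)) :
  nbhs x U <-> exists2 W, nbhs (set_val x) W & set_val @^-1` W `<=` U.
Proof.
split=> [[_ [[W oW <-] Wx WU]]|[W Wx WU]].
  by exists W => //; apply: open_nbhs_nbhs.
exact: (@filterS _ (nbhs x) _ _ _ WU (@initial_continuous _ T set_val x W Wx)).
Qed.

Lemma compact_set_type (C : set T) : C `<=` S -> compact C ->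
  compact (set_val @^-1` C : set (set_type S)).
Proof.
move=> CS cC F PF FC; have [//|p [Cp clp]] := cC (set_val @ F) _.
exists (SigSub (mem_set (CS _ Cp))); split=> // G B FG /nbhs_set_typeP[W Wp WB].
have [_ [[x Gx <-] Wx]] : (set_val @` G) `&` W !=set0.
  by apply: clp => //; apply: (@filterS _ F _ G) => // x Gx; exists x.
by exists x; split=> //; exact: WB.
Qed.

Lemma hausdorff_set_type : hausdorff_space T -> hausdorff_space (set_type S).
Proof.
move=> hT x y clxy; apply/val_inj/hT => V W Vx Wy.
have [z [Vz Wz]] :
    (set_val @^-1` V : set (set_type S)) `&` set_val @^-1` W !=set0.
  by apply: clxy; apply/nbhs_set_typeP; [exists V|exists W].
by exists (set_val z).
Qed.

End SetTypeTopology.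

Section SelfAdjointParts.
Variables (R : realType) (A : cstarAlgType R).
Implicit Types (a b : A).

Definition re_part a : A := (2^-1)%:C *: (a + cstar a).
Definition im_part a : A := (0 -i* 2^-1)%C *: (a - cstar a).

Lemma cstar0 : cstar (0 : A) = 0.
Proof. by apply: (addrI (cstar (0 : A))); rewrite -cstarD !addr0. Qed.

Lemma cstarN a : cstar (- a) = - cstar a.
Proof. by apply/eqP; rewrite -subr_eq0 opprK -cstarD addNr cstar0. Qed.

Lemma cstarZr (r : R) a : cstar (r%:C *: a) = r%:C *: cstar a.
Proof.
by rewrite cstarZ; congr (_ *: _); apply/eqP; rewrite eq_complex /= oppr0 !eqxx.
Qed.

Lemma re_part_sa a : self_adjoint (re_part a).
Proof.
by rewrite /self_adjoint /= /re_part cstarZr cstarD cstarK addrC.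
Qed.

Lemma im_part_sa a : self_adjoint (im_part a).
Proof.
rewrite /self_adjoint /= /im_part cstarZ cstarD cstarN cstarK -opprB.
rewrite scalerN -scaleNr; congr (_ *: _).
by apply/eqP; rewrite eq_complex /= oppr0 !opprK !eqxx.
Qed.

Lemma re_im_partE a : a = re_part a + (0 +i* 1)%C *: im_part a.
Proof.
rewrite /re_part /im_part scalerA.
have -> : (0 +i* 1)%C * (0 -i* 2^-1)%C = (2^-1)%:C :> R[i].
  by apply/eqP; rewrite eq_complex /=; apply/andP; split; apply/eqP; ring.
rewrite -scalerDr addrACA subrr addr0 -[a + a]mulr2n.
rewrite -[a *+ 2]scaler_nat scalerA.
rewrite -(rmorph_nat (real_complex R)) -rmorphM /= mulVf ?pnatr_eq0 //.
by rewrite scale1r.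
Qed.

End SelfAdjointParts.

Section ComplexContinuity.
Variables (R : realType) (T : topologicalType).
Implicit Types f g : T -> R[i]^o.

Lemma continuousCB f g : continuous f -> continuous g ->
  continuous (fun x => f x - g x : R[i]^o).
Proof. by move=> cf cg x; apply: cvgB; [exact: cf|exact: cg]. Qed.

Lemma continuousCD f g : continuous f -> continuous g ->
  continuous (fun x => f x + g x : R[i]^o).
Proof. by move=> cf cg x; apply: cvgD; [exact: cf|exact: cg]. Qed.

Lemma continuousCM f g : continuous f -> continuous g ->
  continuous (fun x => (f x : R[i]) * g x : R[i]^o).
Proof.
by move=> cf cg x; apply: (@cvgZ R[i] R[i]^o _ (nbhs x)); [exact: cf|exact: cg].
Qed.

End ComplexContinuity.

Section CharacterSpace.
Variables (R : realType) (A : cstarAlgType R).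

(** The characters together with the zero functional: unlike [characters] this
    set is compact, whether or not the algebra has a unit. *)
Definition characters0 : set {ptws A -> R[i]^o} :=
  [set phi | scalar phi /\ forall a b, phi (a ** b) = phi a * phi b].

Lemma eval_continuous (a : A) :
  continuous (fun phi : {ptws A -> R[i]^o} => phi a).
Proof. exact: (@proj_continuous A (fun=> R[i]^o) a). Qed.

Lemma closed_characters0 : closed characters0.
Proof.
have -> : characters0 =
  (\bigcap_(u in [set: R[i] * A * A])
     [set phi : {ptws A -> R[i]^o} |
       phi (u.1.1 *: u.1.2 + u.2) - (u.1.1 * phi u.1.2 + phi u.2) = 0]) `&`
  (\bigcap_(u in [set: A * A])
     [set phi : {ptws A -> R[i]^o} |
       phi (u.1 ** u.2) - phi u.1 * phi u.2 = 0]).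
  apply/seteqP; split=> phi.
    move=> [ps pM]; split=> u _ /=; first by rewrite ps subrr.
    by rewrite pM subrr.
  move=> [ps pM]; split=> [l a b|a b]; apply/eqP; rewrite -subr_eq0; apply/eqP.
    exact: (ps (l, a, b)).
  exact: (pM (a, b)).
have closed0 (h : {ptws A -> R[i]^o} -> R[i]^o) : continuous h ->
    closed [set phi | h phi = 0].
  move=> /continuous_closedP/(_ [set 0]); apply.
  have hC := @norm_hausdorff _ R[i]^o.
  exact: (@accessible_closed_set1 _ (hausdorff_accessible hC)).
apply: closedI; apply: closed_bigI => u _; apply: closed0.
  apply: continuousCB; first exact: eval_continuous.
  apply: continuousCD; last exact: eval_continuous.
  by apply: continuousCM; [exact: cst_continuous|exact: eval_continuous].
apply: continuousCB; first exact: eval_continuous.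
by apply: continuousCM; exact: eval_continuous.
Qed.

Lemma compact_characters0 : compact characters0.
Proof.
apply: (subclosed_compact closed_characters0
  (@tychonoff A (fun=> R[i]^o) (fun a => [set z | nrm z <= nrm a]) _)).
  by move=> a; exact: compact_disc.
by move=> phi [ps pM] a; exact: char_bound.
Qed.

End CharacterSpace.

(** * The Gelfand transform and generating sets *)

Section GelfandTransform.
Variables (R : realType) (A : cstarAlgType R) (abelA : abelian_alg A).
Implicit Types (a b : A) (S : set A).

Local Notation K := (set_type (characters0 (A := A))).

Let ev (chi : K) : A -> R[i] := set_val chi.

Let ev_scalar chi : scalar (ev chi).
Proof. by case: (set_valP chi). Qed.

Let evM chi a b : ev chi (a ** b) = ev chi a * ev chi b.
Proof. by case: (set_valP chi). Qed.

Lemma zero_characters0 : characters0 (fun _ : A => 0 : R[i]^o).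
Proof. by split=> [l a b|a b]; rewrite ?mulr0 ?addr0. Qed.

Definition zero_char : K := SigSub (mem_set zero_characters0).

Let ev0 a : ev zero_char a = 0. Proof. by []. Qed.

Let ev_inj chi chi' : (forall a, ev chi a = ev chi' a) -> chi = chi'.
Proof. by move=> e; apply: val_inj; apply/funext. Qed.

Lemma gelfand_continuous a :
  continuous (fun chi : K => (set_val chi : {ptws A -> R[i]^o}) a).
Proof.
move=> chi; apply: (@continuous_comp _ _ _ (set_val : K -> {ptws A -> R[i]^o})
  (fun phi : {ptws A -> R[i]^o} => phi a)).
  exact: initial_continuous.
exact: eval_continuous.
Qed.

Lemma gelfand_Re_continuous a :
  continuous (fun chi : K => complex.Re (set_val chi a)).
Proof.
move=> chi; apply: (@continuous_comp _ R[i]^o _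
  (fun chi : K => (set_val chi : {ptws A -> R[i]^o}) a)).
  exact: gelfand_continuous.
exact: continuous_Re.
Qed.

Lemma compact_character_space : compact [set: K].
Proof.
have -> : [set: K] = set_val @^-1` characters0 (A := A).
  by apply/seteqP; split=> // chi _; exact: set_valP.
exact: compact_set_type (@compact_characters0 R A).
Qed.

Lemma gelfand_isometry_le a (e : R) :
  0 <= e -> (forall chi : K, nrm (set_val chi a : R[i]) <= e) -> nrm a <= e.
Proof.
move=> e0 He; have [->|a0] := eqVneq a 0; first by rewrite nrm0.
have [phi [ps pM _] <-] := ex_norming_character abelA a0.
exact: (He (SigSub (mem_set (conj ps pM : characters0 phi)))).
Qed.

(** The real values of the elements of [B] form an algebra of functions on [K]
    that vanish at the zero functional.  As it separates the points of [K], it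
    interpolates any function vanishing at the zero functional at any two
    points: for two distinct characters [chi] and [chi'], linear algebra does
    it once [u] and [v] in [B] are found with
    [chi u * chi' v <> chi v * chi' u], and [v = u u] serves unless a character
    vanishes at [u].  The theorem of Stone and Weierstrass then applies. *)
Lemma gelfand_approx (B : set A) (f : K -> R) :
  B `<=` @self_adjoint R A -> B 0 ->
  (forall a b, B a -> B b -> B (a + b)) ->
  (forall a b, B a -> B b -> B (a ** b)) ->
  (forall (r : R) a, B a -> B (r%:C *: a)) ->
  (forall chi chi' : K, chi <> chi' -> exists2 b, B b &
     set_val chi b <> set_val chi' b) ->
  continuous f -> f zero_char = 0 ->
  forall e, 0 < e -> exists2 b, B b & forall chi,
    `|f chi - complex.Re (set_val chi b)| <= e.
Proof.
move=> Bsa B0 BD BM BZ Bsep cf f0 e e0.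
pose r (chi : K) b := complex.Re (ev chi b).
have rE chi b : B b -> ev chi b = (r chi b)%:C.
  move=> /Bsa; apply: char_selfadjoint; first exact: ev_scalar.
  exact: evM.
have rD chi a b : r chi (a + b) = r chi a + r chi b.
  rewrite /r (charD (@ev_scalar chi)).
  by case: (ev chi a) (ev chi b) => ? ? [].
have rM chi a b : B a -> B b -> r chi (a ** b) = r chi a * r chi b.
  by move=> Ba Bb; rewrite {1}/r evM !rE //= mulr0 subr0.
have rZ chi (t : R) a : r chi (t%:C *: a) = t * r chi a.
  rewrite /r (charZ (@ev_scalar chi)).
  by case: (ev chi a) => ? ?; rewrite /= mul0r subr0.
have rsep chi chi' : chi <> chi' -> exists2 b, B b & r chi b != r chi' b.
  move=> /Bsep[b Bb ne]; exists b => //; apply: contra_notN ne => /eqP e1.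
  by rewrite -/(ev chi b) -/(ev chi' b) !rE // e1.
have rnz chi : chi <> zero_char -> exists2 b, B b & r chi b != 0.
  by move=> /rsep[b Bb]; rewrite {2}/r ev0; exists b.
pose L := [set g : K -> R | exists2 b, B b & g = r^~ b].
have [|||||||_ [b Bb ->] fb] :=
  @stone_weierstrass R K L _ _ _ _ _ _ f cf _ e e0.
- exact: compact_character_space.
- by move=> _ [b _ ->]; exact: gelfand_Re_continuous.
- exists 0 => //; apply/funext => chi.
  by rewrite /r (char0 (@ev_scalar chi)).
- move=> _ _ [a Ba ->] [b Bb ->]; exists (a + b); first exact: BD.
  by apply/funext => chi; rewrite rD.
- move=> _ _ [a Ba ->] [b Bb ->]; exists (a ** b); first exact: BM.
  by apply/funext => chi; rewrite rM.
- move=> t _ [a Ba ->]; exists (t%:C *: a); first exact: BZ.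
  by apply/funext => chi; rewrite rZ.
- suff interp chi chi' : exists2 b, B b & r chi b = f chi /\ r chi' b = f chi'.
    move=> x y; have [b Bb [? ?]] := interp x y.
    by exists (r^~ b); split=> //; exists b.
  have one x : exists2 b, B b & r x b = f x.
    have [->|/eqP/rnz[b Bb nb]] := eqVneq x zero_char.
      by exists 0 => //; rewrite f0.
    by exists ((f x / r x b)%:C *: b); [exact: BZ|rewrite rZ divfK].
  have [->|/eqP ne] := eqVneq chi chi'.
    by have [b Bb rb] := one chi'; exists b.
  have [chi0|/eqP chi_n0] := eqVneq chi zero_char.
    have [b Bb rb] := one chi'; exists b => //; split=> //.
    by rewrite chi0 f0.
  have [chi0'|/eqP chi_n0'] := eqVneq chi' zero_char.
    have [b Bb rb] := one chi; exists b => //; split=> //.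
    by rewrite chi0' f0.
  have [u [v [Bu Bv det]]] : exists u v, [/\ B u, B v &
      r chi u * r chi' v - r chi v * r chi' u != 0].
    have [u Bu ru] := rsep _ _ ne.
    have [u0|u_n0] := eqVneq (r chi u) 0.
      have [v Bv rv] := rnz _ chi_n0; exists u, v; split=> //.
      by rewrite u0 mul0r sub0r oppr_eq0 mulf_neq0 // -u0 eq_sym.
    have [u0'|u_n0'] := eqVneq (r chi' u) 0.
      have [v Bv rv] := rnz _ chi_n0'; exists u, v; split=> //.
      by rewrite u0' mulr0 subr0 mulf_neq0.
    exists u, (u ** u); split=> //; first exact: BM.
    rewrite !rM //.
    have -> : r chi u * (r chi' u * r chi' u) - r chi u * r chi u * r chi' u =
        r chi u * r chi' u * (r chi' u - r chi u) by ring.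
    by rewrite !mulf_neq0 // subr_eq0 eq_sym.
  pose D := r chi u * r chi' v - r chi v * r chi' u.
  exists (((f chi * r chi' v - f chi' * r chi v) / D)%:C *: u +
          ((f chi' * r chi u - f chi * r chi' u) / D)%:C *: v).
    by apply: BD; apply: BZ.
  rewrite !rD !rZ /D; move: det.
  move: (r chi u) (r chi v) (r chi' u) (r chi' v) (f chi) (f chi').
  by move=> p q s t x y det; split; field.
by exists b.
Qed.

Let ev_sa chi a : self_adjoint a -> ev chi a = (complex.Re (ev chi a))%:C.
Proof. by apply: char_selfadjoint; [exact: ev_scalar|exact: evM]. Qed.

Lemma self_adjoint_closed : [/\ self_adjoint (0 : A),
  (forall a b : A, self_adjoint a -> self_adjoint b -> self_adjoint (a + b)),
  (forall a b : A, self_adjoint a -> self_adjoint b -> self_adjoint (a ** b)) &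
  (forall (t : R) a, self_adjoint a -> self_adjoint (t%:C *: a))].
Proof.
split; rewrite /self_adjoint /=.
- exact: cstar0.
- by move=> a b ea eb; rewrite cstarD ea eb.
- by move=> a b ea eb; rewrite cstarM ea eb abelA.
- by move=> t a ea; rewrite cstarZr ea.
Qed.

Lemma sa_separate (chi chi' : K) :
  chi <> chi' -> exists2 a, self_adjoint a & set_val chi a <> set_val chi' a.
Proof.
move=> ne; apply: contra_notP ne => nsep; apply: ev_inj => a.
have sa b : self_adjoint b -> ev chi b = ev chi' b.
  by move=> bsa; apply: contrapT => nb; apply: nsep; exists b.
have evE c : ev c a = ev c (re_part a) + (0 +i* 1)%C * ev c (im_part a).
  by rewrite -(charZ (ev_scalar c)) -(charD (ev_scalar c)) -re_im_partE.
by rewrite !evE (sa _ (re_part_sa a)) (sa _ (im_part_sa a)).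
Qed.

(** By isometry, uniform approximations of [f] by elements of the algebra form a
    Cauchy sequence; the real part is taken to make its limit self-adjoint. *)
Lemma gelfand_surjective (f : K -> R) : continuous f -> f zero_char = 0 ->
  exists2 a, self_adjoint a & forall chi, set_val chi a = (f chi)%:C.
Proof.
move=> cf f0; have [sa0 saD saM saZ] := self_adjoint_closed.
have approx (n : nat) : exists b, self_adjoint b /\
    forall chi, nrm ((f chi)%:C - ev chi b) <= n.+1%:R^-1.
  have [//|||b bsa fb] := @gelfand_approx (@self_adjoint R A) f
      _ sa0 saD saM saZ _ cf f0 n.+1%:R^-1.
  - exact: sa_separate.
  - by rewrite invr_gt0.
  exists b; split=> // chi; rewrite ev_sa // -rmorphB nrmCR; exact: fb.
have [b bP] := choice approx.
have small (e : R) : 0 < e -> exists N, forall n, (N <= n)%N -> n.+1%:R^-1 < e.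
  move=> e0; exists (Num.trunc e^-1) => n Nn.
  rewrite invf_plt ?posrE // (lt_le_trans (truncnS_gt _)) //.
  by rewrite ler_nat ltnS.
have [l bl] : exists l, forall e : R, 0 < e -> exists N, forall n, (N <= n)%N ->
     nrm (l - b n) < e.
  apply: nrm_complete => e e0.
  have e2 : 0 < e / 2 / 2 by rewrite !divr_gt0.
  have [N NP] := small _ e2; exists N => m n Nm Nn.
  have -> : e = e / 2 + e / 2 by rewrite -splitr.
  apply: (@le_lt_trans _ _ (e / 2)); last by rewrite ltrDl divr_gt0.
  apply: gelfand_isometry_le; first by rewrite divr_ge0 // ltW.
  move=> chi; rewrite -/(ev chi _) (charB (ev_scalar _)).
  apply: le_trans (nrm_triangle (f chi)%:C _ _) _; rewrite (splitr (e / 2)).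
  apply: lerD; last by apply: le_trans (proj2 (bP n) chi) _; exact/ltW/NP.
  by rewrite nrm_distC; apply: le_trans (proj2 (bP m) chi) _; exact/ltW/NP.
have lE chi : ev chi l = (f chi)%:C.
  apply/eqP; rewrite -subr_eq0 -nrm_eq0 eq_le nrm_ge0 andbT.
  apply/ler_addgt0Pl => e e0; rewrite addr0.
  have e2 : 0 < e / 2 by rewrite divr_gt0.
  have [N NP] := small _ e2; have [M MP] := bl _ e2.
  pose n := maxn N M; rewrite (splitr e).
  apply: le_trans (nrm_triangle (ev chi (b n)) _ _) _; apply: lerD.
    rewrite -(charB (ev_scalar _)); apply: le_trans (char_bound _ _ _) _.
    + exact: ev_scalar.
    + exact: evM.
    + by apply/ltW/MP; rewrite leq_maxr.
  rewrite nrm_distC; apply: le_trans (proj2 (bP n) chi) _.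
  by apply/ltW/NP; rewrite leq_maxl.
exists (re_part l); first exact: re_part_sa.
move=> chi; have := lE chi; rewrite {1}(re_im_partE l).
rewrite (charD (ev_scalar chi)) (charZ (ev_scalar chi) _ (im_part l)).
rewrite -/(ev chi _) (ev_sa chi (re_part_sa l)) (ev_sa chi (im_part_sa l)).
move=> /eqP; rewrite eq_complex /= => /andP[/eqP fE _].
by rewrite -fE; congr (_%:C); ring.
Qed.

End GelfandTransform.

Section LinearSpan.
Variables (R : realType) (A : cstarAlgType R).
Implicit Types (a b x y : A) (E S : set A).

Lemma linear_span_mem E x : E x -> linear_span E x.
Proof.
move=> Ex; exists 1%N, (fun=> 1), (fun=> x); split=> //.
by rewrite big_ord1 scale1r.
Qed.

Lemma linear_span0 E : linear_span E 0.
Proof.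
exists 0%N, (fun=> 0), (fun=> 0); split; first by case.
by rewrite big_ord0.
Qed.

Lemma linear_spanZ E (l : R[i]) x : linear_span E x -> linear_span E (l *: x).
Proof.
move=> [n [c [e [Ee ->]]]]; exists n, (fun i => l * c i), e; split=> //.
by rewrite scaler_sumr; apply: eq_bigr => i _; rewrite scalerA.
Qed.

Lemma linear_spanD E x y :
  linear_span E x -> linear_span E y -> linear_span E (x + y).
Proof.
move=> [m [c [e [Ee ->]]]] [n [d [f [Ef ->]]]].
exists (m + n)%N,
  (fun i : 'I_(m + n) =>
     match fintype.split i with inl j => c j | inr k => d k end),
  (fun i : 'I_(m + n) =>
     match fintype.split i with inl j => e j | inr k => f k end).
split=> [i|]; first by case: (fintype.split i).
rewrite big_split_ord /=; congr (_ + _); apply: eq_bigr => i _.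
  by rewrite (unsplitK (inl i)).
by rewrite (unsplitK (inr i)).
Qed.

Lemma linear_span_sum E (n : nat) (F : 'I_n -> A) :
  (forall i, linear_span E (F i)) -> linear_span E (\sum_(i < n) F i).
Proof.
move=> EF; elim/big_ind: _ => //; first exact: linear_span0.
by move=> x y; exact: linear_spanD.
Qed.

Lemma foldl_cmul x y (t : seq A) : foldl cmul (x ** y) t = x ** foldl cmul y t.
Proof. by elim: t y => //= z t IH y; rewrite -cmulA IH. Qed.

Lemma products_mul S a b : products S a -> products S b -> products S (a ** b).
Proof.
move=> [s [t [Ss St ->]]] [s' [t' [Ss' St' ->]]].
exists s, (t ++ s' :: t'); split=> //.
  by move=> x; rewrite mem_cat inE => /or3P[/St|/eqP ->|/St'].
by rewrite foldl_cat /= foldl_cmul.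
Qed.

Lemma products_mem S s : S s -> products S s.
Proof. by move=> Ss; exists s, [::]; split. Qed.

Lemma linear_span_mul E x y : (forall a b, E a -> E b -> E (a ** b)) ->
  linear_span E x -> linear_span E y -> linear_span E (x ** y).
Proof.
move=> EM [m [c [e [Ee ->]]]] [n [d [f [Ef ->]]]].
rewrite (big_morph (fun z => z ** _) (fun u v => cmulDl u v _) (cmul0r _)).
apply: linear_span_sum => i; rewrite cscalerAl; apply: linear_spanZ.
rewrite (big_morph (cmul (e i)) (cmulDr _) (cmulr0 _)).
apply: linear_span_sum => j; rewrite cscalerAr.
exact/linear_spanZ/linear_span_mem/EM.
Qed.

End LinearSpan.

Section Generation.
Variables (R : realType) (A : cstarAlgType R) (abelA : abelian_alg A).
Local Notation K := (set_type (characters0 (A := A))).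

(** The self-adjoint elements of the span of the products of [S] form an algebra
    to which [gelfand_approx] applies, and uniform approximation on the
    characters is approximation in norm. *)
Theorem separating_generates (S : set A) :
  S !=set0 -> S `<=` @self_adjoint R A ->
  (forall chi chi' : K, chi <> chi' -> exists2 s, S s &
     set_val chi s <> set_val chi' s) ->
  generates S.
Proof.
move=> S0 Ssa Ssep; split=> //.
pose B : set A := linear_span (products S) `&` @self_adjoint R A.
have [sa0 saD saM saZ] := self_adjoint_closed abelA.
have real_approx a : self_adjoint a -> forall e : R, 0 < e ->
    exists2 b, B b & nrm (a - b) <= e.
  move=> asa e e0.
  have [||||||||b [Bb bsa] ab] := @gelfand_approx R A B
    (fun chi : K => complex.Re (set_val chi a)) _ _ _ _ _ _ _ _ e e0.
  - by move=> b [].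
  - by split; [exact: linear_span0|].
  - move=> b c [Eb bsa] [Ec csa]; split; [exact: linear_spanD|exact: saD].
  - move=> b c [Eb bsa] [Ec csa]; split; last exact: saM.
    by apply: linear_span_mul => // ? ?; exact: products_mul.
  - by move=> t b [Eb bsa]; split; [exact: linear_spanZ|exact: saZ].
  - move=> chi chi' /Ssep[s Ss ne]; exists s => //.
    by split; [exact/linear_span_mem/products_mem|exact: Ssa].
  - exact: gelfand_Re_continuous.
  - by [].
  exists b; first by split.
  apply: (gelfand_isometry_le abelA (ltW e0)) => chi.
  have [cs cM] : characters0 (set_val chi) := set_valP chi.
  rewrite (charB cs) (char_selfadjoint cs cM asa) (char_selfadjoint cs cM bsa).
  by rewrite -rmorphB nrmCR; exact: ab.
apply/seteqP; split=> // a _ U /nbhs_nrmP[e e0 eU].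
have e2 : 0 < e / 3 by rewrite divr_gt0.
have [b [Eb _] ab] := real_approx _ (re_part_sa a) _ e2.
have [c [Ec _] ac] := real_approx _ (im_part_sa a) _ e2.
exists (b + (0 +i* 1)%C *: c); split; first exact/linear_spanD/linear_spanZ.
apply: eU; rewrite {1}(re_im_partE a) opprD addrACA -scalerBr.
apply: le_lt_trans (nrmD _ _) _; rewrite nrmZ.
have -> : nrm (0 +i* 1 : R[i])%C = 1.
  by rewrite /nrm normc_def /= expr0n /= add0r expr1n sqrtr1.
by rewrite mul1r; move: ab ac; lra.
Qed.

End Generation.

Section VanishingAtInfinity.
Variables (R : realType) (A : cstarAlgType R) (abelA : abelian_alg A).
Local Notation K := (set_type (characters0 (A := A))).

Lemma character_characters0 (phi : A -> R[i]) :
  characters phi -> characters0 phi.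
Proof. by case. Qed.

Definition Delta_point (x : Delta A) : K :=
  SigSub (mem_set (character_characters0 (set_valP x))).

Lemma character_space_cases (chi : K) :
  (exists x, chi = Delta_point x) \/ chi = zero_char A.
Proof.
have [cs cM] : characters0 (set_val chi) := set_valP chi.
have [cchi|chi0] := characters0P cs cM.
  by left; exists (SigSub (mem_set cchi)); exact: val_inj.
by right; apply: val_inj.
Qed.

Lemma Delta_point_neq0 x : Delta_point x <> zero_char A.
Proof.
have [_ _ [a /eqP xa]] := set_valP x.
by move=> /(congr1 (fun chi : K => set_val chi a)).
Qed.

Lemma eval_Delta_continuous a :
  continuous (fun x : Delta A => (set_val x : {ptws A -> R[i]^o}) a).
Proof.
move=> x; apply: (@continuous_comp _ _ _
  (set_val : Delta A -> {ptws A -> R[i]^o})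
  (fun phi : {ptws A -> R[i]^o} => phi a)).
  exact: initial_continuous.
exact: eval_continuous.
Qed.

(** A function on [Delta A] that vanishes at infinity extends by zero to a
    continuous function on the compact space [K]. *)
Lemma gelfand_surjective_Delta (f : Delta A -> R) : continuous f ->
  (forall e, 0 < e -> compact [set x | e <= `|f x|]) ->
  exists2 a, self_adjoint a & forall x : Delta A, set_val x a = (f x)%:C.
Proof.
move=> cf f_infty.
pose g (chi : K) : R :=
  if pselect (characters (set_val chi)) is left h then f (SigSub (mem_set h))
  else 0.
have gx x : g (Delta_point x) = f x.
  rewrite /g; case: pselect => [h|[]]; last exact: set_valP x.
  by congr f; exact: val_inj.
have g0 : g (zero_char A) = 0.
  rewrite /g; case: pselect => // h; exfalso.
  by case: h => _ _ [a]; rewrite eqxx.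
have cg : continuous g.
  move=> chi; apply/(@cvgrPdist_lt _ _ _ (nbhs chi)) => e e0.
  have [[x ->]|->] := character_space_cases chi.
    have : nbhs x [set y | `|f x - f y| < e].
      by have /cvgrPdist_lt := cf x; apply.
    move=> /nbhs_set_typeP[W Wx WU].
    have [_ _ [a xa]] := set_valP x.
    apply/nbhs_set_typeP.
    exists (W `&` [set phi : {ptws A -> R[i]^o} | phi a != 0]).
      apply: filterI => //.
      have : nbhs (set_val x a : R[i]^o) [set z : R[i]^o | z != 0].
        apply/nbhs_nrmP; exists (nrm (set_val x a : R[i])).
          by rewrite nrm_gt0.
        by move=> z; apply: contraTneq => ->; rewrite subr0 ltxx.
      exact: (@eval_continuous R A a (set_val x)).
    move=> chi' [Wchi' chi'a] /=.
    have [[y chi'E]|chi'0] := character_space_cases chi'.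
      rewrite chi'E !gx; apply: WU.
      by rewrite /= -[set_val y]/(set_val (Delta_point y)) -chi'E.
    by move: chi'a; rewrite chi'0 /= eqxx.
  pose D := (set_val : Delta A -> {ptws A -> R[i]^o}) @` [set x | e <= `|f x|].
  have cD : compact D.
    apply: continuous_compact (f_infty _ e0).
    by apply: continuous_subspaceT; exact: initial_continuous.
  have hP : hausdorff_space {ptws A -> R[i]^o}.
    by apply: (@hausdorff_product A (fun=> R[i]^o)) => _; exact: norm_hausdorff.
  apply/nbhs_set_typeP; exists (~` D).
    apply: open_nbhs_nbhs; split.
      exact: (closed_openC (compact_closed hP cD)).
    by move=> [x _ x0]; apply: (@Delta_point_neq0 x); exact: val_inj.
  move=> chi' /= nD; rewrite g0 sub0r normrN ltNge; apply/negP => eg.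
  have [[y chi'E]|chi'0] := character_space_cases chi'.
    apply: nD; exists y; last by rewrite chi'E.
    by move: eg; rewrite chi'E gx.
  by move: eg; rewrite chi'0 g0 normr0 leNgt e0.
have [a asa ga] := gelfand_surjective abelA cg g0.
by exists a => // x; have := ga (Delta_point x); rewrite gx.
Qed.

End VanishingAtInfinity.

(** * Weight, density and generators *)

Lemma card_pair_le (T : Type) : infinite_set [set: T] ->
  [set: T * T] #<= [set: T].
Proof.
move=> Tinf; apply: card_le_trans (card_seq_le Tinf).
by apply/card_le_injP; exists (fun u => [:: u.1; u.2]) => -[a b] [c d] [-> ->].
Qed.

Lemma card_rational_combinations_le (T : Type) : infinite_set [set: T] ->
  [set: seq ((rat * rat) * seq T)] #<= [set: T].
Proof.
move=> Tinf; have /card_le_injP[f f_inj] := card_seq_le Tinf.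
have /card_le_injP[g g_inj] : [set: rat * rat] #<= [set: T].
  move/infiniteP: Tinf => natT.
  apply: card_le_trans natT.
  by have := card_rat2; rewrite card_eq_le => /andP[].
apply/card_le_injP; exists (fun s => f (map (fun u => f [:: g u.1; f u.2]) s)).
move=> s s' /f_inj; apply: inj_map => -[q w] [q' w'] /f_inj/=.
by move=> [/g_inj-> /f_inj->].
Qed.

Section Density.
Variables (R : realType) (A : cstarAlgType R).
Implicit Types (S : set A).

Lemma rational_approx (z : R[i]) (e : R) : 0 < e ->
  exists q : rat * rat, nrm (z - (ratr q.1 +i* ratr q.2)%C) < e.
Proof.
case: z => a b e0; have e2 : 0 < e / 2 by rewrite divr_gt0.
have near_rat (x : R) : exists q : rat, `|x - ratr q| < e / 2.
  have /rat_in_itvoo[q] : x - e / 2 < x + e / 2 by lra.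
  rewrite in_itv /= => /andP[q1 q2]; exists q.
  by rewrite ltr_norml; apply/andP; split; lra.
have [p pa] := near_rat a; have [q qb] := near_rat b.
by exists (p, q); apply: le_lt_trans (nrmC_le _) _ => /=; lra.
Qed.

(** The combinations with complex rational coefficients of products of
    generators are dense, and no more numerous than the generators. *)
Lemma ex_dense_of_generates S : infinite_set S -> generates S ->
  exists2 D : set A, dense D & D #<= S.
Proof.
move=> Sinf [_ _ Sgen].
have Sinf' : infinite_set [set: set_type S].
  move=> Sfin; apply: Sinf; apply: card_le_finite Sfin.
  by have := card_set_type S; rewrite card_eq_sym card_eq_le => /andP[].
pose letter (s : set_type S) : A := set_val s.
pose word (w : seq (set_type S)) : A :=
  if w is s :: t then foldl cmul (letter s) (map letter t) else 0.
pose comb (u : seq ((rat * rat) * seq (set_type S))) : A :=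
  \sum_(v <- u) (ratr v.1.1 +i* ratr v.1.2)%C *: word v.2.
exists (range comb); last first.
  apply: card_le_trans (card_image_le _ _) _.
  apply: card_le_trans (card_rational_combinations_le Sinf') _.
  by have := card_set_type S; rewrite card_eq_le => /andP[].
pose Y : set A := [set y | forall e : R, 0 < e ->
  exists u, nrm (y - comb u) < e].
have Y0 : Y 0 by move=> e e0; exists [::]; rewrite /comb big_nil subrr nrm0.
have YD y z : Y y -> Y z -> Y (y + z).
  move=> Yy Yz e e0; have e2 : 0 < e / 2 by rewrite divr_gt0.
  have [u yu] := Yy _ e2; have [v zv] := Yz _ e2; exists (u ++ v).
  rewrite /comb big_cat opprD addrACA (splitr e).
  by apply: le_lt_trans (nrmD _ _) _; exact: ltrD.
have word_products p : products S p -> exists w, p = word w.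
  move=> [s [t [Ss St ->]]].
  have [t' ->] : exists t', t = map letter t'.
    elim: t St => [|x t IH] St; first by exists [::].
    have [|t' ->] := IH; first by move=> y yt; apply: St; rewrite inE yt orbT.
    have Sx : S x by apply: St; rewrite mem_head.
    by exists (SigSub (mem_set Sx) :: t').
  by exists (SigSub (mem_set Ss) :: t').
have YZ (c : R[i]) p : products S p -> Y (c *: p).
  move=> /word_products[w ->] e e0.
  have np : 0 < nrm (word w) + 1 by rewrite ltr_wpDl // nrm_ge0.
  have [|q qc] := @rational_approx c (e / (nrm (word w) + 1)).
    by rewrite divr_gt0.
  exists [:: (q, w)]; rewrite /comb big_seq1 /= -scalerBl nrmZ.
  move: qc; rewrite ltr_pdivlMr // mulrDr mulr1; apply: le_lt_trans.
  by rewrite lerDl nrm_ge0.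
have spanY y : linear_span (products S) y -> Y y.
  move=> [n [c [p [Sp ->]]]].
  by elim/big_ind: _ => // i _; exact: YZ.
move=> O [x Ox] oO.
have [y [Ey Oy]] : linear_span (products S) `&` O !=set0.
  have : closure (linear_span (products S)) x by rewrite Sgen.
  by apply; exact: open_nbhs_nbhs.
have /nbhs_nrmP[e e0 eO] : nbhs y O by exact: open_nbhs_nbhs.
have [u yu] := spanY _ Ey _ e0.
by exists (comb u); split; [exact: eO|exists u].
Qed.

End Density.

Section Weight.
Variables (R : realType) (A : cstarAlgType R) (abelA : abelian_alg A).
Local Notation K := (set_type (characters0 (A := A))).

Lemma hausdorff_ptws (I : Type) (X : topologicalType) :
  hausdorff_space X -> hausdorff_space {ptws I -> X}.
Proof. by move=> hX; apply: (@hausdorff_product {classic I} (fun=> X)). Qed.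

Lemma hausdorff_character_space : hausdorff_space K.
Proof. exact/hausdorff_set_type/hausdorff_ptws/norm_hausdorff. Qed.

Lemma urysohn_character_space (chi : K) (O : set K) : open O -> O chi ->
  exists f : K -> R, [/\ continuous f, f chi = 1 &
    forall chi', ~ O chi' -> f chi' = 0].
Proof.
move=> oO Ochi.
have clO : closed (~` O) by exact: open_closedC.
have clchi : closed [set chi].
  exact: (compact_closed hausdorff_character_space (@compact_set1 _ chi)).
have disj : ~` O `&` [set chi] = set0.
  by rewrite -subset0 => chi' [nO /= E]; apply: nO; rewrite E.
have /(@uniform_separatorP _ R)[f [cf _ f0 f1]] :=
  normal_uniform_separator
    (compact_normal hausdorff_character_space (compact_character_space (A := A)))
    clO clchi disj.
exists f; split=> //; first by apply: f1; exists chi.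
by move=> chi' nO; apply: f0; exists chi'.
Qed.

(** The open sets where [|d| > 1 / 2], with [d] in the dense set, form a base:
    given a neighbourhood of [x], some [a] has value [1] at [x] and [0] outside
    the neighbourhood, and any [d] with [|a - d| < 1 / 2] will do. *)
Lemma ex_basis_of_dense (D : set A) : dense D ->
  exists2 B : set (set (Delta A)), basis B & B #<= D.
Proof.
move=> Ddense.
pose V (d : A) : set (Delta A) := [set x | 2^-1 < nrm (set_val x d : R[i])].
exists (V @` D); last exact: card_image_le.
split.
  move=> _ [d _ <-].
  have -> : V d =
    (fun x : Delta A => nrm ((set_val x : {ptws A -> R[i]^o}) d)) @^-1`
      [set r | 2^-1 < r] by [].
  apply: open_comp; last exact: open_gt.
  move=> x _; apply: (@continuous_comp _ R[i]^o R
    (fun x : Delta A => (set_val x : {ptws A -> R[i]^o}) d)).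
    exact: eval_Delta_continuous.
  exact: continuous_nrm.
move=> x U /nbhs_set_typeP[W]; rewrite nbhsE => -[Q [oQ Qx] QW] WU.
have [_ _ [c xc]] := set_valP x.
pose O' : set K := (set_val @^-1` Q) `&`
  [set chi | (set_val chi : {ptws A -> R[i]^o}) c != 0].
have oO' : open O'.
  apply: openI.
    by apply: open_comp => // chi _; exact: initial_continuous.
  have -> : [set chi : K | (set_val chi : {ptws A -> R[i]^o}) c != 0] =
    (fun chi : K => nrm ((set_val chi : {ptws A -> R[i]^o}) c)) @^-1`
      [set r | 0 < r].
    by apply/seteqP; split=> chi /=; rewrite nrm_gt0.
  apply: open_comp; last exact: open_gt.
  move=> chi _; apply: (@continuous_comp _ R[i]^o R
    (fun chi : K => (set_val chi : {ptws A -> R[i]^o}) c)).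
    exact: gelfand_continuous.
  exact: continuous_nrm.
have [f [cf fx f0]] :=
  urysohn_character_space oO' (conj Qx xc : O' (Delta_point x)).
have fz : f (zero_char A) = 0 by apply: f0 => -[_]; rewrite /= eqxx.
have [a asa af] := gelfand_surjective abelA cf fz.
have [d [ad Dd]] : interior [set y : A | nrm (a - y) < 2^-1] `&` D !=set0.
  apply: Ddense; last exact: open_interior.
  by exists a; apply: nbhs_nrm; rewrite invr_gt0.
have {}ad : nrm (a - d) < 2^-1 by exact: (interior_subset ad).
have close (y : Delta A) : nrm ((set_val y a : R[i]) - set_val y d) < 2^-1.
  have [ys yM _] : characters (set_val y) := set_valP y.
  by rewrite -(charB ys); apply: le_lt_trans (char_bound ys yM _) ad.
exists (V d).
  split; first by exists d.
  have := close x; have -> : set_val x a = 1 :> R[i].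
    by have := af (Delta_point x); rewrite fx.
  have := nrmD ((1 : R[i]) - set_val x d) (set_val x d).
  by rewrite subrK nrmC1 /V /=; lra.
move=> y Vy; apply: WU; apply: QW; apply: contrapT => nQ.
have fy : f (Delta_point y) = 0 by apply: f0 => -[].
have := close y; have -> : set_val y a = 0 :> R[i].
  by have := af (Delta_point y); rewrite fy.
by move: Vy; rewrite /V /= sub0r nrmN; lra.
Qed.

(** For every pair of basic open sets one self-adjoint element is chosen that
    takes distinct values on them, if there is one; these elements separate the
    characters.  The diagonal pairs provide the elements that separate the
    characters from zero. *)
Lemma ex_generates_of_basis (B : set (set (Delta A))) :
  (exists x : Delta A, True) -> basis B ->
  exists2 S : set A, generates S & exists F, S = F @` (B `*` B).
Proof.
move=> [x0 _] [Bopen Bbase].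
pose P (UV : set (Delta A) * set (Delta A)) (a : A) := self_adjoint a /\
  if pselect (UV.1 = UV.2) then forall x, UV.1 x -> set_val x a <> 0 :> R[i]
  else forall x y, UV.1 x -> UV.2 y -> set_val x a <> set_val y a :> R[i].
have [F FP] : {F & forall UV, self_adjoint (F UV) /\
    ((exists a, P UV a) -> P UV (F UV))}.
  apply: (@choice _ _ (fun UV b => self_adjoint b /\
    ((exists a, P UV a) -> P UV b))) => UV.
  have [[a Pa]|nP] := pselect (exists a, P UV a).
    by exists a; split=> //; case: Pa.
  by exists 0; split=> //; exact: cstar0.
exists (F @` (B `*` B)); last by exists F.
have nbB (x : Delta A) (U : set (Delta A)) : nbhs x U ->
    exists V, [/\ B V, V x & V `<=` U].
  by move=> /Bbase[V [BV Vx] VU]; exists V.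
have [U0 [BU0 _ _]] := nbB x0 setT filterT.
have near_eval (x : Delta A) (a : A) (e : R) : 0 < e ->
    nbhs x [set y : Delta A | nrm ((set_val x a : R[i]) - set_val y a) < e].
  move=> e0; have xe := @nbhs_nrm R R[i]^o (set_val x a) e e0.
  exact: (@eval_Delta_continuous R A a x _ xe).
have nonzero (x : Delta A) : exists2 s, (F @` (B `*` B)) s &
    set_val x s <> 0 :> R[i].
  have [a asa xa] := sa_separate (@Delta_point_neq0 _ _ x).
  have xa0 : 0 < nrm (set_val x a : R[i]) by rewrite nrm_gt0; apply/eqP.
  have [U [BU Ux Ua]] := nbB _ _ (near_eval x a _ xa0).
  have [_ [|_]] := FP (U, U).
    exists a; split=> //=; case: pselect => // _ y /Ua /=.
    by apply: contraPnot => ->; rewrite subr0 ltxx.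
  case: pselect => //= _ /(_ x Ux) ne; exists (F (U, U)) => //.
  by exists (U, U).
apply: separating_generates => //.
- by exists (F (U0, U0)), (U0, U0).
- by move=> _ [UV _ <-]; case: (FP UV).
move=> chi chi'; have [[x ->]|->] := character_space_cases chi;
  have [[y ->]|->] := character_space_cases chi' => // ne.
- have [a asa xya] := sa_separate ne.
  pose e := nrm ((set_val x a : R[i]) - set_val y a).
  have e0 : 0 < e by rewrite nrm_gt0 subr_eq0; apply/eqP.
  have e2 : 0 < e / 2 by rewrite divr_gt0.
  have [U [BU Ux Ua]] := nbB _ _ (near_eval x a _ e2).
  have [V [BV Vy Va]] := nbB _ _ (near_eval y a _ e2).
  have sep u v : U u -> V v -> set_val u a <> set_val v a :> R[i].
    move=> /Ua /= ua /Va /= va uv.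
    have := nrm_triangle (set_val u a : R[i]) (set_val x a) (set_val y a).
    by rewrite {2}uv (nrm_distC (set_val v a)) -/e; lra.
  have [_ [|_]] := FP (U, V).
    exists a; split=> //=; case: pselect => // UV; exfalso.
    by apply: (sep x x) => //; rewrite -UV.
  case: pselect => /= [UV|_ /(_ x y Ux Vy) ne'].
    by exfalso; apply: (sep x x) => //; rewrite -UV.
  by exists (F (U, V)) => //; exists (U, V).
- by have [s Ss xs] := nonzero x; exists s.
- by have [s Ss xs] := nonzero y; exists s => // /esym.
Qed.

End Weight.

(** * Embeddings of the spectrum into powers of the line *)

Lemma compact_topological_embedding (X Y : topologicalType) (f : X -> Y) :
  compact [set: X] -> hausdorff_space Y -> continuous f -> injective f ->
  topological_embedding f.
Proof.
move=> cX hY cf f_inj.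
have fP x : (range f) (f x) by exists x.
pose h x : set_type (range f) := SigSub (mem_set (fP x)).
have [g gP] : {g : set_type (range f) -> X & forall y, f (g y) = set_val y}.
  apply: (@choice _ _ (fun (y : set_type (range f)) x => f x = set_val y)) => y.
  by have [x _ fx] := set_valP y; exists x.
exists h; split=> //; split.
  move=> x U /nbhs_set_typeP[W Wx WU].
  have nW : nbhs x (f @^-1` W) := cf x _ Wx.
  by apply: (@filterS _ (nbhs x) _ _ _ _ nW) => z Wz; apply: WU.
exists g; split.
- apply/continuous_closedP => C clC.
  have -> : g @^-1` C = set_val @^-1` (f @` C).
    apply/seteqP; split=> y /=; first by move=> Cgy; exists (g y).
    by move=> [x Cx fx]; rewrite (_ : g y = x) //; apply: f_inj; rewrite gP.
  have /continuous_closedP cval :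
      continuous (set_val : set_type (range f) -> Y).
    exact: initial_continuous.
  apply: cval.
  apply: compact_closed hY _; apply: continuous_compact.
    exact: continuous_subspaceT.
  exact: subclosed_compact clC cX _.
- by move=> x; apply: f_inj; rewrite gP.
- by move=> y; apply: val_inj; exact: gP.
Qed.

Lemma topological_embedding_continuous (X Y : topologicalType) (f : X -> Y) :
  topological_embedding f -> continuous f /\ injective f.
Proof.
move=> [h [[ch [g [_ hK _]]] hf]]; split.
  have -> : f = set_val \o h by apply/funext => x; rewrite /= hf.
  move=> x; apply: continuous_comp; first exact: ch.
  exact: initial_continuous.
by move=> x y fxy; apply: (can_inj hK); apply: val_inj; rewrite -!set_valE !hf.
Qed.

Section Spectrum.
Variables (R : realType) (A : cstarAlgType R) (abelA : abelian_alg A).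
Local Notation K := (set_type (characters0 (A := A))).
Implicit Types (a b s : A) (x : Delta A).

Lemma unit_characters (e : A) : (forall a, e ** a = a /\ a ** e = a) ->
  forall x, set_val x e = 1 :> R[i].
Proof.
move=> eP x; have [_ xM [a xa]] := set_valP x.
by apply: (mulIf xa); rewrite mul1r -xM (eP a).1.
Qed.

Lemma compact_Delta_unital : unital A -> compact [set: Delta A].
Proof.
move=> [e eP].
have chE : characters (A := A) = characters0 (A := A) `&`
    [set phi : {ptws A -> R[i]^o} | phi e = 1].
  apply/seteqP; split=> [phi [ps pM [a pa]]|phi [[ps pM] pe]].
    by split=> //=; apply: (mulIf pa); rewrite mul1r -pM (eP a).1.
  by split=> //; exists e; rewrite pe oner_neq0.
have cC : compact (characters (A := A)).
  rewrite chE; apply: compact_closedI; first exact: compact_characters0.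
  have /continuous_closedP/(_ [set 1]) := @eval_continuous R A e.
  have hC := @norm_hausdorff _ R[i]^o.
  by apply; exact: (@accessible_closed_set1 _ (hausdorff_accessible hC)).
have -> : [set: Delta A] = set_val @^-1` characters (A := A).
  by apply/seteqP; split=> // x _; exact: set_valP.
exact: compact_set_type cC.
Qed.

Lemma compact_eval_ge a (e : R) : 0 < e ->
  compact [set x : Delta A | e <= nrm (set_val x a : R[i])].
Proof.
move=> e0.
pose C : set {ptws A -> R[i]^o} := characters0 (A := A) `&`
  [set phi : {ptws A -> R[i]^o} | e <= nrm (phi a)].
have cC : compact C.
  apply: compact_closedI; first exact: compact_characters0.
  have /continuous_closedP/(_ _ (@closed_ge R e)) :
      continuous (fun phi : {ptws A -> R[i]^o} => nrm (phi a)).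
    move=> phi; apply: (@continuous_comp _ R[i]^o R
      (fun phi : {ptws A -> R[i]^o} => phi a)).
      exact: eval_continuous.
    exact: continuous_nrm.
  by [].
have -> : [set x : Delta A | e <= nrm (set_val x a : R[i])] = set_val @^-1` C.
  apply/seteqP; split=> x; last by case.
  by move=> xe; split=> //; exact/character_characters0/set_valP.
apply: compact_set_type cC => phi [[ps pM] pe]; split=> //; exists a.
by rewrite -nrm_gt0; exact: lt_le_trans pe.
Qed.

(** Sending the point at infinity, if any, to the zero functional maps the
    compact space [LA] into the space of characters and zero; this makes a
    common treatment of the unital and the nonunital case possible. *)
Lemma LA_evaluation : exists ev : LA A -> A -> R[i],
  [/\ compact [set: LA A],
      forall a, continuous (fun o => ev o a : R[i]^o),
      forall o, characters0 (ev o),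
      injective ev &
      forall x, exists o, ev o = set_val x].
Proof.
rewrite /LA; case: pselect => [unitA|nunitA].
  exists (fun x => set_val x); split.
  - exact: compact_Delta_unital.
  - exact: eval_Delta_continuous.
  - by move=> x; exact/character_characters0/set_valP.
  - exact: val_inj.
  - by move=> x; exists x.
exists (fun o => if o is Some x then set_val (x : Delta A) else fun=> 0); split.
- exact: one_point_compactification_compact.
- move=> a [x|].
    move=> U /(@eval_Delta_continuous R A a x).
    by rewrite /= /nbhs /=.
  move=> U /nbhs_nrmP[e e0 eU].
  have cC := @compact_eval_ge a e e0.
  exists [set x : Delta A | e <= nrm (set_val x a : R[i])].
    split=> //.
    have /continuous_closedP/(_ _ (@closed_ge R e)) :
        continuous (fun x : Delta A =>
          nrm ((set_val x : {ptws A -> R[i]^o}) a)).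
      move=> x; apply: (@continuous_comp _ R[i]^o R
        (fun x : Delta A => (set_val x : {ptws A -> R[i]^o}) a)).
        exact: eval_Delta_continuous.
      exact: continuous_nrm.
    by [].
  move=> _ [[x /= nx <-]|->] /=; apply: eU.
    by rewrite sub0r nrmN ltNge; apply/negP.
  by rewrite subrr nrm0.
- move=> [x|]; last exact: zero_characters0.
  exact/character_characters0/set_valP.
- move=> [x|] [y|] //= xy.
  + by congr Some; exact: val_inj.
  + have [_ _ [a /eqP[]]] := set_valP x.
    exact: (congr1 (fun phi : A -> R[i] => phi a) xy).
  + have [_ _ [a /eqP[]]] := set_valP y.
    exact: (congr1 (fun phi : A -> R[i] => phi a) (esym xy)).
- by move=> x; exists (Some x).
Qed.

Lemma generates_separates (S : set A) (phi psi : A -> R[i]) :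
  generates S -> characters0 phi -> characters0 psi ->
  (forall s, S s -> phi s = psi s) -> phi = psi.
Proof.
move=> [_ _ Sgen] [ps pM] [qs qM] eqS; apply/funext => a.
have eq_prod p : products S p -> phi p = psi p.
  move=> [s [t [Ss St ->]]]; move: (eqS s Ss) => {Ss} es.
  elim: t s es St => //= x t IH s es St.
  apply: IH => [|y yt]; last by apply: St; rewrite inE yt orbT.
  by rewrite pM qM es eqS //; apply: St; rewrite mem_head.
have eq_span y : linear_span (products S) y -> phi y = psi y.
  move=> [n [c [p [Sp ->]]]].
  rewrite (big_morph phi (charD ps) (char0 ps)).
  rewrite (big_morph psi (charD qs) (char0 qs)).
  by apply: eq_bigr => i _; rewrite (charZ ps) (charZ qs) eq_prod.
apply/eqP; rewrite -subr_eq0 -nrm_eq0 eq_le nrm_ge0 andbT.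
apply/ler_addgt0Pl => e e0; rewrite addr0.
have e2 : 0 < e / 2 by rewrite divr_gt0.
have [y [Ey ay]] :
    linear_span (products S) `&` [set y | nrm (a - y) < e / 2] !=set0.
  have : closure (linear_span (products S)) a by rewrite Sgen.
  by apply; exact: nbhs_nrm.
apply: le_trans (nrm_triangle (phi y) _ _) _; rewrite (splitr e); apply: lerD.
  by rewrite -(charB ps); apply: le_trans (char_bound ps pM _) _; exact: ltW.
rewrite eq_span // nrm_distC -(charB qs).
by apply: le_trans (char_bound qs qM _) _; exact: ltW.
Qed.

(** The values at the generators embed [LA], and the Gelfand transform, being
    injective, bounds the number of generators by that of the continuous
    functions on [LA]. *)
Lemma EC_of_generates (S : set A) : generates S -> EC R (LA A) (set_type S).
Proof.
move=> Sgen; have [_ Ssa _] := Sgen.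
have [ev [cLA cev ev0 ev_inj evD]] := LA_evaluation.
have evE o s : S s -> ev o s = (complex.Re (ev o s))%:C.
  by move=> /Ssa; have [es eM] := ev0 o; exact: char_selfadjoint.
split.
  pose ev_fun (s : A) : continuousType (LA A) R[i]^o := mkcts (cev s).
  apply/card_le_injP; exists (fun s : set_type S => ev_fun (set_val s)) => s t st.
  apply: val_inj; apply/eqP; rewrite -subr_eq0 -nrm_eq0 eq_le nrm_ge0 andbT.
  apply: (gelfand_isometry_le abelA (lexx 0)) => chi.
  have [cs cM] : characters0 (set_val chi) := set_valP chi.
  have [[x ->]|->] := character_space_cases chi; last by rewrite nrm0.
  have [p px] := evD x.
  have [ps pM] := ev0 p.
  have -> : set_val (Delta_point x) (set_val s - set_val t) =
      ev p (set_val s - set_val t) :> R[i] by rewrite px.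
  rewrite (charB ps).
  have : ev p (set_val s) = ev p (set_val t).
    by have := congr1 (fun F : continuousType (LA A) R[i]^o => F p) st.
  by move=> ->; rewrite subrr nrm0.
exists (fun o => (fun s : set_type S => complex.Re (ev o (set_val s)))
  : {ptws set_type S -> R}).
apply: compact_topological_embedding => //.
- exact/hausdorff_ptws/norm_hausdorff.
- move=> o; apply/pointwise_cvgP => s.
  apply: (@continuous_comp _ R[i]^o R (fun o => ev o (set_val s) : R[i]^o)).
    exact: cev.
  exact: continuous_Re.
- move=> o o' oo'; apply: ev_inj; apply: (generates_separates Sgen) => // s Ss.
  rewrite (evE o s Ss) (evE o' s Ss); congr (_%:C).
  exact: (congr1 (fun F => F (SigSub (mem_set Ss))) oo').
Qed.

End Spectrum.

Lemma card_option_le (T : Type) : infinite_set [set: T] ->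
  [set: option T] #<= [set: T].
Proof.
move=> Tinf; apply: card_le_trans (card_seq_le Tinf); apply/card_le_injP.
exists (fun u => if u is Some t then [:: t] else [::]).
by move=> -[t|] [t'|] // [->].
Qed.

Section EmbeddingsGenerate.
Variables (R : realType) (A : cstarAlgType R) (abelA : abelian_alg A).

Lemma generates_of_coordinates (j : Type) (g : j -> Delta A -> R) (e : A) :
  (forall i, continuous (g i)) ->
  (forall i r, 0 < r -> compact [set x | r <= `|g i x|]) ->
  self_adjoint e -> (forall x y, (forall i, g i x = g i y) -> x = y) ->
  (forall x : Delta A, (exists i, g i x <> 0) \/ set_val x e <> 0 :> R[i]) ->
  exists a : j -> A, generates (range a `|` [set e]).
Proof.
move=> cg g_infty esa g_inj g_nz.
have [a aP] : {a : j -> A & forall i, self_adjoint (a i) /\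
    forall x : Delta A, set_val x (a i) = (g i x)%:C}.
  apply: (@choice _ _ (fun i b => self_adjoint b /\
    forall x : Delta A, set_val x b = (g i x)%:C)) => i.
  have [b bsa gb] := gelfand_surjective_Delta abelA (cg i) (g_infty i).
  by exists b.
exists a; apply: separating_generates => //.
- by exists e; right.
- by move=> _ [[i _ <-]|->] //; case: (aP i).
have nonzero (x : Delta A) : exists2 s, (range a `|` [set e]) s &
    set_val x s <> 0 :> R[i].
  have [[i gi]|xe] := g_nz x; last by exists e => //; right.
  exists (a i); first by left; exists i.
  by move=> xa; apply: gi; case: (etrans (esym ((aP i).2 x)) xa).
move=> chi chi'; have [[x ->]|->] := character_space_cases chi;
  have [[y ->]|->] := character_space_cases chi' => // ne.
- have [i gi] : exists i, g i x <> g i y.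
    by apply/existsNP => gxy; apply: ne; congr Delta_point; exact: g_inj.
  exists (a i); first by left; exists i.
  move=> xya; apply: gi.
  by case: (etrans (esym ((aP i).2 x)) (etrans xya ((aP i).2 y))).
- by have [s Ss xs] := nonzero x; exists s.
- by have [s Ss xs] := nonzero y; exists s => // /esym.
Qed.

(** The coordinates of an embedding of [LA] lie in the image of the Gelfand
    transform once their value at infinity (if any) is subtracted; the unit
    (if any) is added in order to separate the characters from zero. *)
Lemma generates_of_embedding (j : Type) (Phi : LA A -> {ptws j -> R}) :
  topological_embedding Phi ->
  exists (a : j -> A) e, generates (range a `|` [set e]).
Proof.
have proj_cont i : continuous (fun f : {ptws j -> R} => f i).
  exact: (@proj_continuous {classic j} (fun=> R) i).
move: Phi; rewrite /LA; case: pselect => [unitA|nunitA] Phi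
  /topological_embedding_continuous[cPhi Phi_inj].
  have [e eP] := unitA.
  have ese : cstar e = e.
    have ceP b : cstar e ** b = b.
      by rewrite -{1}(cstarK b) -cstarM (eP _).2 cstarK.
    by rewrite -(eP (cstar e)).2 ceP.
  have cg i : continuous (fun x => Phi x i).
    move=> x; apply: (@continuous_comp _ _ _ Phi (fun f : {ptws j -> R} => f i)).
      exact: cPhi.
    exact: proj_cont.
  have [|||a Sgen] := @generates_of_coordinates j (fun i x => Phi x i) e
    cg _ ese _ _; last by exists a, e.
  - move=> i r r0.
    apply: subclosed_compact (compact_Delta_unital unitA) _ => //.
    have /continuous_closedP/(_ _ (@closed_ge R r)) :
        continuous (fun x => `|Phi x i|).
      move=> x; apply: (@continuous_comp _ R R (fun x => Phi x i) Num.norm).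
        exact: cg.
      exact: norm_continuous.
    by [].
  - by move=> x y gxy; apply: Phi_inj; apply/funext.
  - move=> x; right; rewrite (unit_characters eP).
    by apply/eqP; exact: oner_neq0.
pose g i (x : Delta A) := Phi (Some x) i - Phi None i.
have cPhi_i i : continuous (fun o => Phi o i).
  move=> o; apply: (@continuous_comp _ _ _ Phi (fun f : {ptws j -> R} => f i)).
    exact: cPhi.
  exact: proj_cont.
have cg i : continuous (g i).
  move=> x; apply: (@cvgB R R _ (nbhs x) _ (fun y : Delta A => Phi (Some y) i)
    (fun=> Phi None i)); last exact: cvg_cst.
  apply: (@continuous_comp _ _ _
    (Some : Delta A -> one_point_compactification (Delta A))
    (fun o => Phi o i)).
    exact: one_point_compactification_some_continuous.
  exact: cPhi_i.
have [|||a Sgen] := @generates_of_coordinates j g 0 cg _ (cstar0 A) _ _;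
  last by exists a, 0.
- move=> i r r0.
  have : nbhs (None : one_point_compactification (Delta A))
      [set o | `|Phi None i - Phi o i| < r].
    by have /cvgrPdist_lt := cPhi_i i None; apply.
  move=> [C [cC clC] CP]; apply: subclosed_compact cC _.
    have /continuous_closedP/(_ _ (@closed_ge R r)) : continuous (fun x => `|g i x|).
      move=> x; apply: (@continuous_comp _ R R (g i) Num.norm); first exact: cg.
      exact: norm_continuous.
    by [].
  move=> x /= rx; apply: contrapT => nC.
  have := CP (Some x) (or_introl (ex_intro2 _ _ x nC erefl)).
  by rewrite /= distrC ltNge rx.
- move=> x y gxy; have : Some x = Some y; last by case.
  by apply: Phi_inj; apply/funext => i; exact: addIr (gxy i).
- move=> x; left; apply/existsNP => gx0.
  have : Some x = None; last by [].
  apply: Phi_inj; apply/funext => i; apply/eqP.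
  by rewrite -subr_eq0; apply/eqP; exact: gx0.
Qed.

End EmbeddingsGenerate.

Theorem proposition3p12 (R : realType) (A : cstarAlgType R)
    (abelA : abelian_alg A) (nfgA : ~ finitely_generated A) :
  exists k : Type,
    [/\ is_weight (Delta A) k, is_density A k, is_gen A k
      & is_min_EC R (LA A) k].
Proof.
have gen_infinite (S : set A) : generates S -> infinite_set S.
  by move=> Sgen Sfin; apply: nfgA; exists S.
have sa_gen : generates (@self_adjoint R A).
  apply: separating_generates => //; first by exists 0; exact: cstar0.
  exact: sa_separate.
have [[S Sgen] Smin] := @ex_least_card {S : set A | generates S}
  (fun S => set_type (sval S)) (exist _ _ sa_gen).
have {}Smin (S' : set A) : generates S' -> [set: set_type S] #<= S'.
  move=> S'gen; apply: card_le_trans (Smin (exist _ _ S'gen)) _ => /=.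
  by have := card_set_type S'; rewrite card_eq_le => /andP[].
have S_le : S #<= [set: set_type S].
  by have := card_set_type S; rewrite card_eq_le => /andP[].
(* Without characters, the algebra would be [0] and generated by [0]. *)
have Delta_inhabited : exists x : Delta A, True.
  apply: contrapT => noDelta.
  have /gen_infinite : generates [set 0 : A]; last by apply; exact: finite_set1.
  apply: separating_generates => //; first by exists 0.
    by move=> _ ->; exact: cstar0.
  move=> chi chi'; have [[x _]|->] := character_space_cases chi.
    by case: noDelta; exists x.
  have [[x _]|->] := character_space_cases chi'; last by [].
  by case: noDelta; exists x.
have basis_ge (B : set (set (Delta A))) : basis B -> [set: set_type S] #<= B.
  move=> Bbasis.
  have [S' S'gen [F S'E]] := ex_generates_of_basis abelA Delta_inhabited Bbasis.
  have Binf : infinite_set B.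
    move=> Bfin; apply: (gen_infinite _ S'gen); rewrite S'E.
    by apply: finite_image; exact: finite_setX.
  have TBinf : infinite_set [set: set_type B].
    move=> TBfin; apply: Binf; apply: card_le_finite TBfin.
    by have := card_set_type B; rewrite card_eq_le => /andP[].
  apply: card_le_trans (Smin _ S'gen) _.
  apply: (@card_le_trans _ _ _ [set: set_type B]); last first.
    by have := card_set_type B; rewrite card_eq_le => /andP[].
  apply: card_le_trans (card_pair_le TBinf).
  have -> : S' = (fun u : set_type B * set_type B =>
      F (set_val u.1, set_val u.2)) @` setT.
    rewrite S'E; apply/seteqP; split=> [_ [[U V] [/= BU BV] <-]|_ [[U V] _ <-]].
      by exists (SigSub (mem_set BU), SigSub (mem_set BV)).
    by exists (set_val U, set_val V) => //; split; exact: set_valP.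
  exact: card_image_le.
have dense_ge (D : set A) : dense D -> [set: set_type S] #<= D.
  move=> /(ex_basis_of_dense abelA)[B Bbasis BD].
  exact: card_le_trans (basis_ge _ Bbasis) BD.
have [D Ddense DS] := ex_dense_of_generates (gen_infinite _ Sgen) Sgen.
have [B Bbasis BD] := ex_basis_of_dense abelA Ddense.
exists (set_type S); split.
- split=> [|B' B'basis]; last exact: basis_ge.
  exists B => //; rewrite card_eq_le basis_ge // andbT.
  exact: card_le_trans BD (card_le_trans DS S_le).
- split=> [|D' D'dense]; last exact: dense_ge.
  exists D => //; rewrite card_eq_le dense_ge // andbT.
  exact: card_le_trans DS S_le.
- split=> [|S' S'gen]; last exact: Smin.
  by exists S => //; rewrite card_eq_sym; exact: card_set_type.
split=> [|j [_ [Phi Phi_emb]]]; first exact: EC_of_generates.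
have [a [e aegen]] := generates_of_embedding abelA Phi_emb.
have jinf : infinite_set [set: j].
  move=> jfin; apply: (gen_infinite _ aegen); rewrite finite_setU; split=> //.
  exact: finite_image.
apply: card_le_trans (Smin _ aegen) _.
apply: card_le_trans (card_option_le jinf).
have -> : range a `|` [set e] =
    (fun u => if u is Some i then a i else e) @` setT.
  apply/seteqP; split=> [_ [[i _ <-]|->]|_ [[i|] _ <-]].
  - by exists (Some i).
  - by exists None.
  - by left; exists i.
  - by right.
exact: card_image_le.
Qed.
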